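(* For $n<3$, $p(n,n-2)=u(n,n-2)=0$, and for every integer $n\ge3$, \[ p(n,n-2)=\tfrac16\,(n-2)\bigl(n^3-2n^2-5n+12\bigr),\qquad u(n,n-2)=\tfrac16\,(n-3)\bigl(n^3-4n^2+2n-2\bigr). \]
   Context: $p(n,l)$ is the number of isomorphism classes of posets with $n$ elements whose longest chain has exactly $l$ elements; $u(n,l)$ is the number of those which are locally unsymmetric. Definitions: $\ell(X)$ is the cardinality of a longest chain of a poset $X$. A subset $A$ of a poset $X$ is maximally ordered in $X$ if $|\{(a,b)\in A\times A:a<b\}|$ is maximal among subsets of $X$ of cardinality $|A|$. For $\sigma\in\mathrm{Aut}(P)$, $\Sigma(\sigma)=\{a:\sigma(a)\ne a\}$. For a finite poset $Q$ and $r\ge2$: $\sigma$ is a $(Q,r)$-generator if there exist subsets $S_0,\dots,S_{r-1}\subset\Sigma(\sigma)$, each isomorphic to $Q$, which are smallest maximally ordered subsets of $\Sigma(\sigma)$ with $\sigma(S_i)=S_{(i+1)\bmod r}$, $\ell(S_i)=\ell(\Sigma(\sigma))$, $\bigcup_iS_i=\Sigma(\sigma)$; distinct $S_i,S_j$ are $(Q,r)$-symmetric subsets. Elements $a,b$ are $(Q,r,0)$-symmetric if $a=b$; $(Q,r,1)$-symmetric if there are $(Q,r)$-symmetric subsets $A,B$ with generator $\sigma$, $a\in A$, $b=\sigma^q(a)\in B$, $1\le q<r$; for $m\ge2$, $(Q,r,m)$-symmetric if not $(Q,r,j)$-symmetric for $j<m$ but there exist $c$, $j<m$ with $a$ $(Q,r,j)$-symmetric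 to $c$ and $c$ $(Q,r,m-j)$-symmetric to $b$; $(Q,r)$-symmetric if $(Q,r,m)$-symmetric for some $m\ge0$ (an equivalence relation). $P\oslash_rQ$ is the quotient poset of equivalence classes with $E\le F$ iff some $e\in E$, $f\in F$ satisfy $e\le f$. A poset $P$ is locally symmetric if $P\oslash_rQ\not\cong P$ for some finite poset $Q$ and some $r\ge2$; it is locally unsymmetric otherwise. *)

(* Defs.v *)
From HB Require Import structures.
From mathcomp Require Import all_boot all_order all_algebra all_fingroup.
From mathcomp Require Import boolp.
Set Implicit Arguments. Unset Strict Implicit. Unset Printing Implicit Defensive.

(* A finite poset on a finite carrier T is encoded by its (reflexive) order
   relation, given as the set of pairs (x, y) with x <= y. *)

Definition leR {T : finType} (R : {set T * T}) (x y : T) : bool := (x, y) \in R.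
Definition ltR {T : finType} (R : {set T * T}) (x y : T) : bool :=
  leR R x y && (x != y).

Definition is_poset {T : finType} (R : {set T * T}) : bool :=
  [&& [forall x, leR R x x],
      [forall x, forall y, leR R x y && leR R y x ==> (x == y)] &
      [forall x, forall y, forall z, leR R x y && leR R y z ==> leR R x z]].

Definition is_chain {T : finType} (R : {set T * T}) (C : {set T}) : bool :=
  [forall x in C, forall y in C, leR R x y || leR R y x].

Definition ell {T : finType} (R : {set T * T}) (X : {set T}) : nat :=
  \max_(C : {set T} | (C \subset X) && is_chain R C) #|C|.

Definition height {T : finType} (R : {set T * T}) : nat := ell R [set: T].

Definition ord_pairs {T : finType} (R : {set T * T}) (A : {set T}) : nat :=
  #|[set ab : T * T | [&& ab.1 \in A, ab.2 \in A & ltR R ab.1 ab.2]]|.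

Definition max_ordered {T : finType} (R : {set T * T}) (X A : {set T}) : bool :=
  (A \subset X) &&
  [forall B : {set T}, (B \subset X) && (#|B| == #|A|) ==>
                       (ord_pairs R B <= ord_pairs R A)].

Definition is_aut {T : finType} (R : {set T * T}) (s : {perm T}) : bool :=
  [forall x, forall y, leR R (s x) (s y) == leR R x y].

Definition Sigma {T : finType} (s : {perm T}) : {set T} := [set a | s a != a].

Definition iso_sub {m : nat} {T : finType} (RQ : {set 'I_m * 'I_m})
    (R : {set T * T}) (A : {set T}) : Prop :=
  exists f : 'I_m -> T,
    [/\ injective f, f @: [set: 'I_m] = A &
        forall x y, leR RQ x y = leR R (f x) (f y)].

(* S_0, ..., S_{r-1} (given as S : nat -> {set T}, indices i < r) witness
   that s is a (Q,r)-generator *)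
Definition gen_family {m : nat} {T : finType} (RQ : {set 'I_m * 'I_m})
    (r : nat) (R : {set T * T}) (s : {perm T}) (S : nat -> {set T}) : Prop :=
  (forall i, (i < r)%N ->
     [/\ iso_sub RQ R (S i),
         max_ordered R (Sigma s) (S i),
         (forall A : {set T}, max_ordered R (Sigma s) A ->
              ell R A = ell R (Sigma s) -> (#|S i| <= #|A|)%N),
         s @: S i = S (i.+1 %% r)%N &
         ell R (S i) = ell R (Sigma s)])
  /\ \bigcup_(i < r) S i = Sigma s.

Definition is_generator {m : nat} {T : finType} (RQ : {set 'I_m * 'I_m})
    (r : nat) (R : {set T * T}) (s : {perm T}) : Prop :=
  is_aut R s /\ exists S, gen_family RQ r R s S.

Definition sym1 {m : nat} {T : finType} (RQ : {set 'I_m * 'I_m})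
    (r : nat) (R : {set T * T}) (a b : T) : Prop :=
  exists s : {perm T}, is_aut R s /\
  exists S, gen_family RQ r R s S /\
  exists i j, [/\ (i < r)%N, (j < r)%N, S i != S j, a \in S i & b \in S j] /\
               exists q, (1 <= q < r)%N /\ b = (s ^+ q)%g a.

(* symR k m a b is "(Q,r,m)-symmetric" for m <= k (k is fuel ensuring
   structural recursion). *)
Fixpoint symR {m : nat} {T : finType} (RQ : {set 'I_m * 'I_m})
    (r : nat) (R : {set T * T}) (k j : nat) (a b : T) : Prop :=
  match k with
  | 0 => j = 0%N /\ a = b
  | k'.+1 =>
    match j with
    | 0 => a = b
    | 1 => sym1 RQ r R a b
    | _ => (~ exists i, (i < j)%N /\ symR RQ r R k' i a b) /\
           exists c i, [/\ (1 <= i < j)%N, symR RQ r R k' i a c &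
                           symR RQ r R k' (j - i) c b]
    end
  end.

Definition symm {m : nat} {T : finType} (RQ : {set 'I_m * 'I_m})
    (r : nat) (R : {set T * T}) (a b : T) : Prop :=
  exists j, symR RQ r R j j a b.

Definition quot_classes {m : nat} {T : finType} (RQ : {set 'I_m * 'I_m})
    (r : nat) (R : {set T * T}) : {set {set T}} :=
  [set [set b | `[< symm RQ r R a b >]] | a : T].

Definition quot_le {T : finType} (R : {set T * T}) (E F : {set T}) : Prop :=
  exists e f, [/\ e \in E, f \in F & leR R e f].

Definition quot_iso {m : nat} {T : finType} (RQ : {set 'I_m * 'I_m})
    (r : nat) (R : {set T * T}) : Prop :=
  exists f : T -> {set T},
    [/\ injective f, f @: [set: T] = quot_classes RQ r R &
        forall x y, leR R x y <-> quot_le R (f x) (f y)].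

Definition locally_symmetric {T : finType} (R : {set T * T}) : Prop :=
  exists (m : nat) (RQ : {set 'I_m * 'I_m}), is_poset RQ /\
  exists r : nat, (2 <= r)%N /\ ~ quot_iso RQ r R.

Definition locally_unsymmetric {T : finType} (R : {set T * T}) : Prop :=
  ~ locally_symmetric R.

Definition iso_posets {n : nat} (R1 R2 : {set 'I_n * 'I_n}) : bool :=
  [exists s : {perm 'I_n}, [forall x, forall y, leR R1 x y == leR R2 (s x) (s y)]].

Definition posets_h (n : nat) (l : int) : {set {set 'I_n * 'I_n}} :=
  [set R : {set 'I_n * 'I_n} | is_poset R && (Posz (height R) == l)].

Definition iso_class {n : nat} (l : int) (R : {set 'I_n * 'I_n}) :=
  [set R' in posets_h n l | iso_posets R R'].

Definition p (n : nat) (l : int) : nat :=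
  #|[set iso_class l R | R in posets_h n l]|.

Definition u (n : nat) (l : int) : nat :=
  #|[set iso_class l R | R in [set R in posets_h n l | `[< locally_unsymmetric R >]]]|.

(* Main.v *)
Require Import Defs.
From HB Require Import structures.
From mathcomp Require Import all_boot all_order all_algebra all_fingroup.
From mathcomp Require Import boolp.
From mathcomp Require Import zify.
Set Implicit Arguments. Unset Strict Implicit. Unset Printing Implicit Defensive.

(* Put [h = n - 2].  A poset of height [h] with [h + 2] elements is a longest
   chain together with two elements [x] and [y], hence is described by how many
   elements of the chain lie below and above [x] and [y], and by whether [x] and
   [y] are comparable.  Several descriptions give isomorphic posets only because
   the longest chain can be rerouted through [x] or [y]; fixing a choice leaves
   one normal form per isomorphism class, and the normal forms are counted by
   polynomials.  That distinct normal forms are not isomorphic is seen on the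
   levels (measured by the longest chain above an element): an isomorphism
   preserves them, and all but at most two levels are singletons, so that it can
   only permute [x], [y] and the elements of the chain on their levels.  These
   permutations also show that a nontrivial automorphism yields either a
   transposition of two elements of a level or a simultaneous transposition in
   two levels matched as two disjoint two-element chains.  In both cases it is a
   (Q,2)-generator with [Q] a chain, so that being locally unsymmetric amounts
   here to having no nontrivial automorphism. *)

(** * Orders, chains and isomorphisms on a finite carrier *)

Section Generalities.
Variable T : finType.
Implicit Types (R : {set T * T}) (s t : {perm T}) (C X K : {set T}).

Lemma posetP R :
  reflect [/\ reflexive (leR R), antisymmetric (leR R) & transitive (leR R)]
          (is_poset R).
Proof.
apply: (iffP and3P) => [[/forallP rR /forallP aR /forallP tR]|[rR aR tR]]; split.
- by [].
- move=> x y; move/forallP: (aR x) => /(_ y) /implyP xy /xy /eqP //.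
- move=> y x z xy yz; move/forallP: (tR x) => /(_ y) /forallP /(_ z).
  by rewrite xy yz.
- exact/forallP.
- by apply/forallP=> x; apply/forallP=> y; apply/implyP=> /aR ->.
- apply/forallP=> x; apply/forallP=> y; apply/forallP=> z.
  by apply/implyP=> /andP[xy yz]; apply: tR yz.
Qed.

Lemma chainP R C :
  reflect (forall x y, x \in C -> y \in C -> leR R x y || leR R y x)
          (is_chain R C).
Proof.
apply: (iffP forall_inP) => [cC x y xC yC|cC x xC].
  by move/forall_inP: (cC _ xC) => /(_ _ yC).
by apply/forall_inP => y yC; apply: cC.
Qed.

Lemma card_chain_ell R X C : C \subset X -> is_chain R C -> #|C| <= ell R X.
Proof.
by move=> sCX cC; rewrite /ell (bigD1 C) ?sCX //= leq_maxl.
Qed.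

Lemma ell_leqP R X m :
  reflect (forall C, C \subset X -> is_chain R C -> #|C| <= m) (ell R X <= m).
Proof.
apply: (iffP (bigmax_leqP _ _ _)) => [le C sC cC|le C /andP[sC cC]]; last exact: le.
by apply: le; rewrite sC.
Qed.

Lemma ell_leq_card R X : ell R X <= #|X|.
Proof. by apply/ell_leqP => C sCX _; apply: subset_leq_card. Qed.

Lemma ell_chain R C : is_chain R C -> ell R C = #|C|.
Proof.
by move=> cC; apply/eqP; rewrite eqn_leq ell_leq_card card_chain_ell.
Qed.

Lemma exists_longest_chain R : exists2 C, is_chain R C & #|C| = height R.
Proof.
have c0 : (set0 \subset [set: T]) && is_chain R set0.
  by rewrite sub0set; apply/chainP => x y; rewrite inE.
have [|C /andP[_ cC] eC] :=
    @eq_bigmax_cond _ (fun C => (C \subset [set: T]) && is_chain R C) (fun C => #|C|).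
  by apply/card_gt0P; exists set0.
by exists C.
Qed.

Definition iso_by R R' (f : T -> T) := forall x y, leR R x y = leR R' (f x) (f y).

Lemma iso_byV R R' t : iso_by R R' t -> iso_by R' R t^-1%g.
Proof. by move=> i x y; rewrite i !permKV. Qed.

Lemma iso_by_comp R R' R'' s t :
  iso_by R R' s -> iso_by R' R'' t -> iso_by R R'' (s * t)%g.
Proof. by move=> i j x y; rewrite !permM i j. Qed.

Lemma is_autP R s : reflect (iso_by R R s) (is_aut R s).
Proof.
apply: (iffP forallP) => [a x y|a x].
  by move/forallP: (a x) => /(_ y) /eqP ->.
by apply/forallP => y; rewrite -a.
Qed.

Lemma iso_by_chain R R' t C : iso_by R R' t -> is_chain R C -> is_chain R' (t @: C).
Proof.
move=> i /chainP cC; apply/chainP => _ _ /imsetP[x xC ->] /imsetP[y yC ->].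
by rewrite -!i cC.
Qed.

Lemma iso_by_height_leq R R' t : iso_by R R' t -> height R <= height R'.
Proof.
move=> i; apply/ell_leqP => C _ cC.
rewrite -(card_imset _ (@perm_inj _ t)).
by apply: card_chain_ell (iso_by_chain i cC); apply: subsetT.
Qed.

Lemma iso_by_height R R' t : iso_by R R' t -> height R = height R'.
Proof.
move=> i; apply/eqP; rewrite eqn_leq (iso_by_height_leq i).
exact: iso_by_height_leq (iso_byV i).
Qed.

Lemma iso_by_poset R R' t : iso_by R R' t -> is_poset R -> is_poset R'.
Proof.
move=> /iso_byV i /posetP[rR aR tR]; apply/posetP; split.
- by move=> x; rewrite i.
- by move=> x y; rewrite !i => /aR /perm_inj.
- by move=> y x z; rewrite !i; apply: tR.
Qed.

Lemma iso_by_down R R' t x : iso_by R R' t ->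
  #|[set y | leR R y x]| = #|[set y | leR R' y (t x)]|.
Proof.
move=> i; rewrite -(card_imset _ (@perm_inj _ t)); apply: eq_card => y.
rewrite !inE; apply/imsetP/idP => [[z]|le_y]; first by rewrite inE i => zx ->.
by exists (t^-1%g y); rewrite ?inE ?i permKV.
Qed.

End Generalities.

(** * Isomorphism classes of posets *)

Section IsoClasses.
Variable n : nat.
Implicit Types R : {set 'I_n * 'I_n}.

Lemma iso_posetsP R R' :
  reflect (exists t : {perm 'I_n}, iso_by R R' t) (iso_posets R R').
Proof.
apply: (iffP existsP) => -[t i]; exists t.
  by move=> x y; move/forallP: i => /(_ x) /forallP /(_ y) /eqP.
by apply/forallP => x; apply/forallP => y; rewrite i.
Qed.

Lemma iso_posets_sym R R' : iso_posets R R' -> iso_posets R' R.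
Proof. by case/iso_posetsP=> t /iso_byV i; apply/iso_posetsP; exists t^-1%g. Qed.

Lemma iso_posets_trans R R' R'' :
  iso_posets R R' -> iso_posets R' R'' -> iso_posets R R''.
Proof.
move=> /iso_posetsP[s i] /iso_posetsP[t j]; apply/iso_posetsP.
by exists (s * t)%g; apply: iso_by_comp i j.
Qed.

Lemma iso_posets_refl R : iso_posets R R.
Proof. by apply/iso_posetsP; exists 1%g => x y; rewrite !perm1. Qed.

Lemma iso_classP l R R' : R' \in posets_h n l ->
  reflect (iso_class l R = iso_class l R') (iso_posets R R').
Proof.
move=> pR'; apply: (iffP idP) => [i|e].
  apply/setP => R''; rewrite !inE; congr (_ && _).
  apply/idP/idP; last exact: iso_posets_trans.
  exact/iso_posets_trans/iso_posets_sym.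
have : R' \in iso_class l R' by rewrite inE pR' iso_posets_refl.
by rewrite -e inE => /andP[].
Qed.

(** Serves with normal forms as [A]: every member of [B] has a normal form, and isomorphic normal
    forms coincide, so classes can be counted as codes. Allowing a subset [B] covers both [p] and
    [u]. *)
Lemma card_iso_classes l (B : {set {set 'I_n * 'I_n}}) (D : finType) (A : {set D})
    (F : D -> {set 'I_n * 'I_n}) :
  B \subset posets_h n l ->
  (forall d, d \in A -> F d \in B) ->
  (forall R, R \in B -> exists2 d, d \in A & iso_posets (F d) R) ->
  {in A &, forall d d', iso_posets (F d) (F d') -> d = d'} ->
  #|[set iso_class l R | R in B]| = #|A|.
Proof.
move=> /subsetP sB FB surF injF.
rewrite -(@card_in_imset _ _ (fun d => iso_class l (F d))) => [|d d' dA d'A].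
  apply: eq_card => c; apply/imsetP/imsetP => [[R RB ->]|[d dA ->]].
    have [d dA i] := surF R RB; exists d => //.
    by apply/esym/iso_classP; first exact: sB.
  by exists (F d); first exact: FB.
by move/iso_classP => /(_ (sB _ (FB _ d'A))); apply: injF.
Qed.

End IsoClasses.

(** * Local symmetry *)

Fixpoint walk (T : Type) (E : T -> T -> Prop) (k : nat) (a b : T) : Prop :=
  if k is k'.+1 then exists2 c, E a c & walk E k' c b else a = b.

Lemma walk_cat (T : Type) (E : T -> T -> Prop) k l a b c :
  walk E k a b -> walk E l b c -> walk E (k + l) a c.
Proof.
elim: k a => [|k IHk] a /=; first by move=> ->.
by case=> d ad db bc; exists d => //; apply: IHk.
Qed.

Section LocalSymmetry.
Variable T : finType.
Implicit Types (R : {set T * T}) (s t : {perm T}) (C X K : {set T}).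

Section Symm.
Variables (m : nat) (RQ : {set 'I_m * 'I_m}) (r : nat) (R : {set T * T}).
Local Notation E := (sym1 RQ r R).

Lemma symR_walk k j a b : symR RQ r R k j a b -> walk E j a b.
Proof.
elim: k j a b => [|k IHk] [|[|j]] a b //=; try by [case | exists b].
case=> _ [c [i [/andP[i_gt0 lt_ij] ac cb]]].
by have := walk_cat (IHk _ _ _ ac) (IHk _ _ _ cb); rewrite subnKC // ltnW.
Qed.

(** Splitting off the first edge gives the intermediate element [c]. The rest of a shortest walk is
    again shortest, so the induction applies to it. *)
Lemma shortest_walk_symR k j a b :
  j <= k -> walk E j a b -> (forall i, i < j -> ~ walk E i a b) ->
  symR RQ r R k j a b.
Proof.
elim: k j a b => [|k IHk] [|[|j]] a b //= le_jk; first by case=> c ? <-.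
case=> c ac cb shortest; split=> [[i [lt_ij /symR_walk]]|]; first exact: shortest.
exists c, 1; split=> //.
  by apply: IHk => [||[] // _ e]; [lia | by exists c | by apply: (shortest j.+1); rewrite ?e].
rewrite subSS subn0; apply: IHk => // i lt_ij w.
by apply: (shortest i.+1) => //; exists c.
Qed.

(** Any walk can be replaced by a shortest one, for which the minimality demanded by [symR] holds.
    So [symm] is the reflexive transitive closure of [sym1]. *)
Lemma symmP a b : symm RQ r R a b <-> exists k, walk E k a b.
Proof.
split=> [[j /symR_walk]|[k w]]; first by exists j.
have exk : exists k, `[< walk E k a b >] by exists k; apply/asboolP.
exists (ex_minn exk); case: ex_minnP => j /asboolP wj min_j.
apply: shortest_walk_symR => // i lt_ij /asboolP /min_j; lia.
Qed.

(** An isomorphism with the quotient would give as many classes as elements and so make the class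
    map [cl] injective. But walks from [a] and from [b] reach the same elements, each of the two
    being one step from the other. *)
Lemma sym1_not_quot_iso a b : a != b -> E a b -> E b a -> ~ quot_iso RQ r R.
Proof.
move=> neq_ab ab ba [f [inj_f im_f _]].
set cl := fun c => [set d | `[< symm RQ r R c d >]].
have cl_inj : injective cl.
  have eq_im : cl @: [set: T] = f @: [set: T].
    by rewrite im_f; apply/setP => A; apply/imsetP/imsetP => -[c _ ->]; exists c.
  have inj_cl : {in [set: T] &, injective cl}.
    by apply/imset_injP; rewrite eq_im card_imset.
  by move=> c d; apply: inj_cl; rewrite inE.
move/eqP: neq_ab; apply; apply: cl_inj; apply/setP => d; rewrite !inE.
apply/asboolP/asboolP => /symmP[k w]; apply/symmP; exists k.+1.
  by exists a.
by exists b.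
Qed.

End Symm.

Definition rigid R := forall s, is_aut R s -> s = 1%g.

(** Every generator is the identity, so [sym1] relates an element only to itself and all classes are
    singletons. *)
Lemma rigid_locally_unsymmetric R : rigid R -> locally_unsymmetric R.
Proof.
move=> rigR [m [RQ [_ [r [_ []]]]]].
have E a b : sym1 RQ r R a b -> a = b.
  by case=> s [/rigR -> [S [_ [i [j [_ [q [_ ->]]]]]]]]; rewrite expg1n perm1.
have symmE a b : symm RQ r R a b <-> a = b.
  split=> [/symmP[k]|->]; last by exists 0.
  by elim: k a => [|k IHk] a //= [c /E -> /IHk].
have clE a : [set b | `[< symm RQ r R a b >]] = [set a].
  by apply/setP => b; rewrite !inE; apply/asboolP/eqP => [/symmE|->] //; apply/symmE.
exists (fun a => [set a]); split; first exact: set1_inj.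
  by apply/setP => A; apply/imsetP/imsetP => -[a _ ->]; exists a; rewrite ?clE.
move=> x y; split=> [xy|[e [f [/set1P -> /set1P ->]]] //].
by exists x, y; rewrite !inE !eqxx.
Qed.

(** The data for a (Q,2)-generator with [S_0 = C], [S_1 = s @: C] and [Q] a chain. The last clause
    makes [C] a longest chain among the moved elements. *)
Definition chain_swap R s C :=
  [/\ is_aut R s, involutive s, is_chain R C, C :|: s @: C = Sigma s & s @: C != C]
  /\ forall K, K \subset Sigma s -> is_chain R K -> #|K| <= #|C|.

(** The strictly ordered pairs, their reversals and the diagonal are disjoint inside [A * A]; they
    fill it exactly when any two elements of [A] are comparable. Hence chains are maximally
    ordered. *)
Lemma ord_pairs_bound R A : is_poset R ->
  (ord_pairs R A).*2 + #|A| <= #|A| * #|A| ?= iff is_chain R A.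
Proof.
move=> /posetP[rR aR _].
pose swap (p : T * T) := (p.2, p.1).
have swapK : involutive swap by case.
pose P := [set ab : T * T | [&& ab.1 \in A, ab.2 \in A & ltR R ab.1 ab.2]].
pose Q := swap @: P; pose D := [set (a, a) | a in A].
have QE a b : ((a, b) \in Q) = [&& a \in A, b \in A & ltR R b a].
  rewrite -[(a, b)]/(swap (b, a)) mem_imset ?inE /=; last exact: inv_inj.
  by rewrite andbCA.
have DE a b : ((a, b) \in D) = (a == b) && (a \in A).
  apply/imsetP/andP => [[c cA [-> ->]]|[/eqP <- aA]]; last by exists a.
  by rewrite eqxx.
have dPQ : [disjoint P & Q].
  rewrite disjoint_subset; apply/subsetP => -[a b]; rewrite !inE QE /ltR /=.
  move=> /and3P[_ _ /andP[ab neq]]; apply/negP => /and3P[_ _ /andP[ba _]].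
  by case/eqP: neq; apply: aR; rewrite ab.
have dD : [disjoint P :|: Q & D].
  rewrite disjoint_subset; apply/subsetP => -[a b].
  rewrite inE [_ \in predC _]inE /= DE QE !inE /= /ltR.
  by case: (eqVneq a b) => [->|_]; rewrite ?andbF.
have cardE : #|P :|: Q :|: D| = (ord_pairs R A).*2 + #|A|.
  have -> : #|A| = #|D| by rewrite card_imset // => a b [].
  have := (leq_card_setU P Q, leq_card_setU (P :|: Q) D).
  rewrite dPQ dD => -[[_ /eqP e1] [_ /eqP e2]].
  by rewrite e2 e1 -addnn (card_imset _ (inv_inj swapK)).
have sub : P :|: Q :|: D \subset setX A A.
  apply/subsetP => -[a b]; rewrite !inE DE QE /=.
  by case/orP => [/orP[]/and3P[-> ->]//|/andP[/eqP <- ->]].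
split; first by rewrite -cardE -cardsX subset_leq_card.
rewrite -cardE -cardsX; have [_ ->] := subset_leqif_cards sub.
apply/eqP/chainP => [e a b aA bA|cA].
  have : (a, b) \in setX A A by rewrite inE aA.
  rewrite -e !inE DE QE /= aA bA /ltR /= => /orP[/orP[]/andP[-> _]|/andP[/eqP-> _]];
  by rewrite ?orbT // rR.
apply/setP=> -[a b]; rewrite !inE DE QE /= /ltR (eq_sym b a).
case aA: (a \in A); case bA: (b \in A); rewrite /= ?orbF ?andbF //=; last first.
  by apply/negbTE/negP=> /andP[/eqP e]; rewrite -e aA in bA.
by have := cA a b aA bA; case: eqVneq => _; rewrite /= ?orbT ?andbT ?orbF.
Qed.

Lemma max_ordered_chain R X C : is_poset R -> C \subset X -> is_chain R C ->
  max_ordered R X C.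
Proof.
move=> pR sCX cC; rewrite /max_ordered sCX; apply/forallP => B.
apply/implyP => /andP[_ /eqP eB].
have [leB _] := ord_pairs_bound B pR.
have [_ ] := ord_pairs_bound C pR; rewrite cC eB in leB * => /eqP eC.
by rewrite -leq_double -(leq_add2r #|C|) eC.
Qed.

Lemma chain_swap_locally_symmetric R s C :
  is_poset R -> chain_swap R s C -> locally_symmetric R.
Proof.
move=> pR [[aut_s sK cC sigE neqC] maxC].
have iS := is_autP _ _ aut_s.
have pR' := posetP _ pR; case: pR' => rR aR tR.
pose f (i : 'I_#|C|) : T := enum_val i.
pose RQ := [set ij : 'I_#|C| * 'I_#|C| | leR R (f ij.1) (f ij.2)].
have leRQ i j : leR RQ i j = leR R (f i) (f j) by rewrite {1}/leR inE.
have im_f : f @: [set: 'I_#|C|] = C.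
  apply/setP => c; apply/imsetP/idP => [[i _ ->]|cC']; first exact: enum_valP.
  by exists (enum_rank_in cC' c); rewrite // /f enum_rankK_in.
have ssC : s @: (s @: C) = C.
  by rewrite -imset_comp (eq_imset (g := id)) ?imset_id // => c /=; rewrite sK.
have cardsC : #|s @: C| = #|C| by rewrite card_imset //; apply: perm_inj.
have ellC : #|C| = ell R (Sigma s).
  apply/eqP; rewrite eqn_leq card_chain_ell //; last by rewrite -sigE subsetUl.
  exact/ell_leqP.
pose S i := if odd i then s @: C else C.
have Schain i : is_chain R (S i) /\ S i \subset Sigma s /\ #|S i| = #|C|.
  rewrite /S -sigE; case: odd; rewrite ?subsetUl ?subsetUr; split=> //.
  exact: iso_by_chain cC.
have fam : gen_family RQ 2 R s S.
  split=> [i lt_i2|]; last by rewrite big_ord_recr big_ord1.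
  have [cS [sS cardS]] := Schain i; split.
  - rewrite /S; case: odd; last by exists f; split=> //; apply: enum_val_inj.
    exists (s \o f); split=> [x y /perm_inj /enum_val_inj||x y] //=.
      by rewrite imset_comp im_f.
    by rewrite leRQ -iS.
  - exact: max_ordered_chain.
  - by move=> A _ eA; rewrite cardS ellC -eA ell_leq_card.
  - by case: i lt_i2 {cS sS cardS} => [|[|]] //= _; rewrite /S /= ssC.
  - by rewrite ell_chain // cardS.
(* The two chains differ and have equal size, so neither contains the other. Such an [a] is moved by
   [s], and [a], [s a] are symmetric in both directions. *)
have [a aC aNsC] : exists2 a, a \in C & a \notin s @: C.
  apply/subsetPn; apply: contra neqC => sub.
  by rewrite eq_sym eqEcard sub cardsC leqnn.
have neq_S : S 0 != S 1 by rewrite eq_sym.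
have sa : s a \in s @: C by rewrite imset_f.
exists #|C|, RQ; split.
  apply/posetP; split=> [x|x y|y x z]; rewrite !leRQ //; last exact: tR.
  by move/aR/enum_val_inj.
exists 2; split=> //; apply: (@sym1_not_quot_iso _ _ _ _ a (s a)).
- by apply: contraNneq aNsC => {1}->.
- exists s; split=> //; exists S; split=> //; exists 0, 1; split=> //.
  by exists 1; rewrite expg1.
- exists s; split=> //; exists S; split=> //; exists 1, 0; split; last first.
    by exists 1; rewrite expg1 sK.
  by split=> //; rewrite eq_sym.
Qed.

Lemma iso_by_conj R R' t s : iso_by R R' t -> is_aut R s -> is_aut R' (s ^ t)%g.
Proof.
move=> i /is_autP a; apply/is_autP => x y.
by rewrite /conjg !permM -i -a (iso_byV i).
Qed.

Lemma iso_by_rigid R R' t : iso_by R R' t -> rigid R -> rigid R'.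
Proof.
move=> /iso_byV i rigR s /(iso_by_conj i) /rigR /(congr1 (fun s => s ^ t)%g).
by rewrite -conjgM mulVg conjg1 conj1g.
Qed.

Lemma iso_by_chain_swap R R' t s C : iso_by R R' t ->
  chain_swap R s C -> chain_swap R' (s ^ t)%g (t @: C).
Proof.
move=> i [[aut_s sK cC sigE neqC] maxC].
have sigJ : Sigma (s ^ t)%g = t @: Sigma s.
  apply/setP => x; apply/idP/imsetP => [|[y + ->]]; rewrite !inE /=.
    move=> sx; exists (t^-1%g x); rewrite ?permKV // inE.
    by apply: contra sx => /eqP e; rewrite /conjg !permM e permKV.
  by rewrite permJ (inj_eq perm_inj).
have imJ : (s ^ t)%g @: (t @: C) = t @: (s @: C).
  by rewrite -!imset_comp; apply: eq_imset => x /=; rewrite permJ.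
split; last first.
  move=> K sK' cK; rewrite (card_imset _ (@perm_inj _ t)).
  rewrite -(card_imset _ (@perm_inj _ t^-1%g)); apply: maxC; last first.
    exact: iso_by_chain (iso_byV i) cK.
  apply/subsetP => _ /imsetP[x /(subsetP sK') + ->].
  by rewrite sigJ => /imsetP[y ys ->]; rewrite permK.
split.
- exact: iso_by_conj aut_s.
- by move=> x; rewrite -[x](permKV t) !permJ sK.
- exact: iso_by_chain cC.
- by rewrite imJ -imsetU sigE.
- by rewrite imJ; apply: contra neqC => /eqP /(imset_inj (@perm_inj _ t)) ->.
Qed.

End LocalSymmetry.

(** * Posets consisting of a chain and two further elements *)

(* The poset described by [d] consists of the chain [0 < ... < h-1] and of two
   further elements [x], coded by [h], and [y], coded by [h.+1].  The elements
   of the chain above [x] are those [>= xtop d], those below [x] are those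
   [< xbot d], similarly for [y]; [yx d] tells whether [y < x], while [x < y]
   never holds. *)
Record params := Params
  { xtop : nat; xbot : nat; ytop : nat; ybot : nat; yx : bool }.

Section Model.
Variable h : nat.
Implicit Types (d e : params) (u v : nat).

Definition mle d u v : bool :=
  if u < h then
    if v < h then u <= v else if v == h then u < xbot d else u < ybot d
  else if u == h then if v < h then xtop d <= v else v == h
  else if v < h then ytop d <= v else (v == h.+1) || yx d.

Definition model d : {set 'I_h.+2 * 'I_h.+2} :=
  [set uv : 'I_h.+2 * 'I_h.+2 | mle d uv.1 uv.2].

Lemma leR_model d (u v : 'I_h.+2) : leR (model d) u v = mle d u v.
Proof. by rewrite /leR inE. Qed.

Lemma mle_cc d u v : u < h -> v < h -> mle d u v = (u <= v).
Proof. by rewrite /mle => -> ->. Qed.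
Lemma mle_cx d u : u < h -> mle d u h = (u < xbot d).
Proof. by rewrite /mle => ->; rewrite ltnn eqxx. Qed.
Lemma mle_cy d u : u < h -> mle d u h.+1 = (u < ybot d).
Proof. by rewrite /mle => ->; rewrite ltnNge leqnSn gtn_eqF. Qed.
Lemma mle_xc d v : v < h -> mle d h v = (xtop d <= v).
Proof. by rewrite /mle => ->; rewrite ltnn eqxx. Qed.
Lemma mle_yc d v : v < h -> mle d h.+1 v = (ytop d <= v).
Proof. by rewrite /mle => ->; rewrite ltnNge leqnSn gtn_eqF. Qed.
Lemma mle_xx d : mle d h h.
Proof. by rewrite /mle ltnn eqxx. Qed.
Lemma mle_xy d : mle d h h.+1 = false.
Proof. by rewrite /mle ltnn ltnNge leqnSn eqxx gtn_eqF. Qed.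
Lemma mle_yx d : mle d h.+1 h = yx d.
Proof. by rewrite /mle ltnn ltnNge leqnSn (gtn_eqF (ltnSn h)) (ltn_eqF (ltnSn h)). Qed.
Lemma mle_yy d : mle d h.+1 h.+1.
Proof. by rewrite /mle ltnNge leqnSn gtn_eqF //= eqxx. Qed.

Variant code_spec : nat -> Prop :=
  | CodeC u of u < h : code_spec u
  | CodeX : code_spec h
  | CodeY : code_spec h.+1.

Lemma codeP u : u < h.+2 -> code_spec u.
Proof.
have [lt_uh _|le_hu lt_u] := ltnP u h; first by constructor.
by have [->|->] : u = h \/ u = h.+1 by [lia]; constructor.
Qed.

End Model.

Ltac mleE :=
  rewrite ?(mle_xx, mle_xy, mle_yx, mle_yy);
  repeat (rewrite -> mle_cx by (assumption || lia));
  repeat (rewrite -> mle_cy by (assumption || lia));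
  repeat (rewrite -> mle_xc by (assumption || lia));
  repeat (rewrite -> mle_yc by (assumption || lia));
  repeat (rewrite -> mle_cc by (assumption || lia)).

(** * Valid descriptions, their levels and down-sets *)

Section ValidModels.
Variable h : nat.
Implicit Types (d e : params) (u v : nat).

(** The conditions express transitivity and height [h]. If [X <= a] or [Y <= b], then [x] or [y]
    could be added to the chain; if [y < x] and [X <= b.+1], replacing the chain element [b] by
    [y < x] would lengthen it. The other inequalities come from transitivity. *)
Definition valid d : bool :=
  let: Params X a Y b r := d in
  [&& a < X <= h, b < Y <= h & if r then [&& b <= a, Y <= X & b.+1 < X]
                               else (a <= Y) && (b <= X)].

(* If [d] is valid, a longest chain with least element [u] has [h - lev d u]
   elements. *)
Definition lev d u : nat :=
  if u < h then u else if u == h then (xtop d).-1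
  else if yx d && (xtop d == ytop d) then (xtop d).-2 else (ytop d).-1.

Lemma lev_c d u : u < h -> lev d u = u.
Proof. by rewrite /lev => ->. Qed.
Lemma lev_x d : lev d h = (xtop d).-1.
Proof. by rewrite /lev ltnn eqxx. Qed.
Lemma lev_y d : lev d h.+1 =
  if yx d && (xtop d == ytop d) then (xtop d).-2 else (ytop d).-1.
Proof. by rewrite /lev ltnNge leqnSn gtn_eqF. Qed.

Lemma model_poset d : valid d -> is_poset (model h d).
Proof.
case: d => X a Y b r /= vd; apply/posetP; split.
- move=> u; rewrite leR_model; case: (codeP (ltn_ord u)) => *; mleE => //=; lia.
- move=> u v; rewrite !leR_model => uv; apply/val_inj; move: uv => /=.
  case: (codeP (ltn_ord u)) => [{}u lt_u||]; case: (codeP (ltn_ord v)) => [{}v lt_v||];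
  mleE => //=; case: r vd => vd; lia.
- move=> v u w; rewrite !leR_model.
  case: (codeP (ltn_ord u)) => [{}u lt_u||]; case: (codeP (ltn_ord v)) => [{}v lt_v||];
  case: (codeP (ltn_ord w)) => [{}w lt_w||]; mleE => //=; case: r vd => vd; lia.
Qed.

Lemma lev_lt d u : valid d -> u < h.+2 -> lev d u < h.
Proof.
case: d => X a Y b r /= vd /codeP[{}u lt_u||]; rewrite ?lev_x ?lev_y ?lev_c //=.
  lia.
by case: r vd => vd /=; try case: ifP => _; lia.
Qed.

Lemma lev_homo d u v : valid d -> u < h.+2 -> v < h.+2 ->
  mle h d u v -> u != v -> lev d u < lev d v.
Proof.
case: d => X a Y b r /= vd /codeP[{}u lt_u||] /codeP[{}v lt_v||]; mleE;
  rewrite ?lev_x ?lev_y ?lev_c //=; case: r vd => vd /=; try case: ifP => ?; lia.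
Qed.

Lemma lev_next d u : valid d -> u < h.+2 -> (lev d u).+1 < h ->
  exists2 v, v < h.+2 & [/\ mle h d u v, u != v & lev d v = (lev d u).+1].
Proof.
case: d => X a Y b r /= vd /codeP[{}u lt_u||]; rewrite ?lev_x ?lev_y ?lev_c //=.
- move=> lt_h; exists u.+1; first lia.
  by mleE; rewrite lev_c //; split=> //; lia.
- move=> lt_h; exists X; first lia.
  by mleE; rewrite lev_c /=; try split; lia.
- case: ifP => [/andP[rT XY] lt_h|rF lt_h].
    by rewrite rT in vd *; exists h => //; mleE; rewrite lev_x /=; split=> //; lia.
  exists Y; first lia.
  by mleE; rewrite lev_c /=; try split; lia.
Qed.

(** Levels strictly increase along a chain, which therefore meets each of them at most once. *)
Lemma chain_card_lev d (C : {set 'I_h.+2}) (L : {set 'I_h}) : valid d ->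
  is_chain (model h d) C -> (forall u : 'I_h.+2, u \in C -> exists2 l, l \in L & lev d u = val l) ->
  #|C| <= #|L|.
Proof.
move=> vd /chainP cC CL.
pose f (u : 'I_h.+2) : 'I_h := Ordinal (lev_lt vd (ltn_ord u)).
rewrite -(@card_in_imset _ _ f) => [|u v uC vC].
  apply/subset_leq_card/subsetP => _ /imsetP[u uC ->].
  by have [l lL e] := CL u uC; rewrite (_ : f u = l) //; apply: val_inj.
move/(congr1 val) => /= e; apply/eqP; apply: contraT => neq_uv.
have := cC u v uC vC; rewrite !leR_model => /orP[] /lev_homo.
  by move/(_ vd (ltn_ord _) (ltn_ord _) neq_uv); rewrite e ltnn.
rewrite eq_sym in neq_uv.
by move/(_ vd (ltn_ord _) (ltn_ord _) neq_uv); rewrite e ltnn.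
Qed.

Lemma height_model d : valid d -> height (model h d) = h.
Proof.
move=> vd; apply/eqP; rewrite eqn_leq; apply/andP; split.
  apply/ell_leqP => C _ cC; rewrite -[h in _ <= h]card_ord -cardsT.
  apply: (chain_card_lev vd cC) => u _.
  by exists (Ordinal (lev_lt vd (ltn_ord u))); rewrite ?inE.
pose c (i : 'I_h) : 'I_h.+2 := widen_ord (leqW (leqnSn h)) i.
have c_inj : injective c by move=> i j /(congr1 val) /= e; apply: val_inj.
rewrite -[h in h <= _]card_ord -cardsT -(card_imset _ c_inj).
apply: card_chain_ell; first exact: subsetT.
apply/chainP => _ _ /imsetP[i _ ->] /imsetP[j _ ->].
rewrite !leR_model /= (mle_cc _ (ltn_ord i) (ltn_ord j)).
by rewrite (mle_cc _ (ltn_ord j) (ltn_ord i)) leq_total.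
Qed.

Lemma sum_ltn_ord m k : \sum_(i < m) (i < k) = minn m k.
Proof.
elim: m => [|m IHm]; first by rewrite big_ord0 min0n.
by rewrite big_ord_recr /= IHm; lia.
Qed.

Lemma sum_eq_ord m l : \sum_(i < m) (i == l :> nat) = (l < m).
Proof.
elim: m => [|m IHm]; first by rewrite big_ord0.
by rewrite big_ord_recr /= IHm; lia.
Qed.

(** The sizes of down-sets are the invariants that separate elements of one level. *)
Lemma down_x d : xbot d <= h ->
  \sum_(u < h.+2) mle h d u h = (xbot d).+1 + yx d.
Proof.
move=> le_h; rewrite !big_ord_recr /=; mleE.
rewrite (eq_bigr (fun i : 'I_h => (i < xbot d) : nat)) => [|i _];
  last by rewrite /= (mle_cx _ (ltn_ord i)).
by rewrite sum_ltn_ord; lia.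
Qed.

Lemma down_y d : ybot d <= h -> \sum_(u < h.+2) mle h d u h.+1 = (ybot d).+1.
Proof.
move=> le_h; rewrite !big_ord_recr /=; mleE.
rewrite (eq_bigr (fun i : 'I_h => (i < ybot d) : nat)) => [|i _];
  last by rewrite /= (mle_cy _ (ltn_ord i)).
by rewrite sum_ltn_ord; lia.
Qed.

Lemma down_c d m : m < h ->
  \sum_(u < h.+2) mle h d u m = m.+1 + (xtop d <= m) + (ytop d <= m).
Proof.
move=> lt_m; rewrite !big_ord_recr /=; mleE.
rewrite (eq_bigr (fun i : 'I_h => (i < m.+1) : nat)) => [|i _];
  last by rewrite /= (mle_cc _ (ltn_ord i) lt_m).
by rewrite sum_ltn_ord; lia.
Qed.

Lemma iso_model_down d e (t : {perm 'I_h.+2}) (u : 'I_h.+2) :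
  iso_by (model h d) (model h e) t ->
  \sum_(v < h.+2) mle h d v u = \sum_(v < h.+2) mle h e v (t u).
Proof.
move=> /(iso_by_down u).
have E f w : #|[set v | leR (model h f) v w]| = \sum_(v < h.+2) mle h f v w.
  rewrite -sum1_card big_mkcond; apply: eq_bigr => v _.
  by rewrite inE leR_model; case: mle.
by rewrite !E.
Qed.

(** Induction downwards from the top level: some [v] above [u] lies just one level higher, and the
    image of [u] is strictly below that of [v]. On the top level the bound is trivial. *)
Lemma iso_model_lev_leq d e (t : {perm 'I_h.+2}) (u : 'I_h.+2) :
  valid d -> valid e -> iso_by (model h d) (model h e) t ->
  lev e (t u) <= lev d u.
Proof.
move=> vd ve i; have [k le_k] := ubnP (h - lev d u).
elim: k u le_k => // k IHk u le_k.
have lt_tu := lev_lt ve (ltn_ord (t u)).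
have [lt_u|] := ltnP (lev d u).+1 h; last lia.
have [v lt_v [uv neq_uv ev]] := lev_next vd (ltn_ord u) lt_u.
have := IHk (Ordinal lt_v); rewrite /= ev => IH.
have : lev e (t u) < lev e (t (Ordinal lt_v)).
  apply: lev_homo => //; first by rewrite -leR_model -i leR_model.
  by rewrite (inj_eq val_inj) (inj_eq perm_inj) -(inj_eq val_inj).
by move=> lt; rewrite -ltnS (leq_trans lt) // IH //; lia.
Qed.

Lemma iso_model_lev d e (t : {perm 'I_h.+2}) (u : 'I_h.+2) :
  valid d -> valid e -> iso_by (model h d) (model h e) t ->
  lev e (t u) = lev d u.
Proof.
move=> vd ve i; apply/eqP; rewrite eqn_leq iso_model_lev_leq //=.
have := iso_model_lev_leq (t u) ve vd (iso_byV i); by rewrite permK.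
Qed.

Lemma card_lev d l :
  \sum_(u < h.+2) (lev d u == l) = (l < h) + (lev d h == l) + (lev d h.+1 == l).
Proof.
rewrite !big_ord_recr /=; congr (_ + _ + _).
by rewrite -sum_eq_ord; apply: eq_bigr => i _; rewrite lev_c.
Qed.

End ValidModels.

(** * Reduced descriptions as normal forms *)

Section ReducedModels.
Variable h : nat.
Implicit Types (d e : params) (u v : nat) (t : {perm 'I_h.+2}).

(* Among the valid descriptions of a poset, this one is singled out as follows.
   If [y < x] fails, the names of [x] and [y] are exchanged when necessary.  If
   [y < x], the case [X = Y = a.+1] is removed by exchanging [x] with [a], and
   the case [a = b], [Y = a.+1] by exchanging [y] with [a]: both turn into
   descriptions in which [y < x] fails. *)
Definition reduced d : bool :=
  let: Params X a Y b r := d in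
  [&& Y <= X <= h, a < X, b < Y &
    if r then (b <= a) && (if X == Y then a.+1 < X else (a.+1 != Y) || (b.+1 != Y))
    else (a <= Y) && ((X == Y) ==> (a <= b))].

Lemma reduced_valid d : reduced d -> valid h d.
Proof. by case: d => X a Y b [] /=; case: eqVneq; lia. Qed.

Lemma tperm_iso_model d e (i j : 'I_h.+2) :
  (forall u, u < h.+2 -> u != i -> u != j ->
     [/\ mle h d u i = mle h e u j, mle h d u j = mle h e u i,
         mle h d i u = mle h e j u & mle h d j u = mle h e i u]) ->
  (forall u v, u < h.+2 -> v < h.+2 -> u != i -> u != j -> v != i -> v != j ->
     mle h d u v = mle h e u v) ->
  [/\ mle h d i j = mle h e j i, mle h d j i = mle h e i j,
      mle h d i i = mle h e j j & mle h d j j = mle h e i i] ->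
  iso_by (model h d) (model h e) (tperm i j).
Proof.
move=> H1 H2 [ij ji ii jj] u v; rewrite !leR_model.
by case: tpermP => [->|->|/eqP + /eqP]; case: tpermP => [->|->|/eqP + /eqP];
   rewrite -?val_eqE //= => *; first [exact: H2 | by case: (H1 v) | by case: (H1 u)].
Qed.

Lemma reduced_form d : valid h d -> exists2 e, reduced e & iso_posets (model h e) (model h d).
Proof.
suff: valid h d -> exists2 e, reduced e &
    exists t : {perm 'I_h.+2}, iso_by (model h d) (model h e) t.
  move=> H /H[e ce [t i]]; exists e => //.
  by apply/iso_posets_sym/iso_posetsP; exists t.
case cd: (reduced d).
  by exists d => //; exists 1%g => x y; rewrite !perm1.
case: d cd => X a Y b [] /= cd vd; last first.
  exists (Params Y b X a false); first by move: cd => /=; case: eqVneq; lia.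
  have lt_h : h < h.+2 by []. have lt_h1 : h.+1 < h.+2 by [].
  exists (tperm (Ordinal lt_h) (Ordinal lt_h1)).
  apply: tperm_iso_model => /= [u|u v|]; last by mleE.
  - by case/codeP => [{}u lt_u||]; rewrite ?eqxx //; mleE.
  - by case/codeP => [{}u lt_u||]; rewrite ?eqxx // => /codeP[{}v lt_v||];
       rewrite ?eqxx //; mleE.
have lt_h : h < h.+2 by []. have lt_h1 : h.+1 < h.+2 by [].
have [eXY|neqXY] := eqVneq X Y.
  subst Y; have eX : X = a.+1 by move: cd; rewrite eqxx; lia.
  subst X.
  have lt_a : a < h.+2 by lia.
  (* Once [x] and [a] are exchanged, [y] lies below the chain element [a], so its upper bound drops
     from [a.+1] to [a], and [y] is no longer below [x]. *)
  exists (Params a.+1 a a b false) => /=; first by case: eqVneq; lia.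
  exists (tperm (Ordinal lt_h) (Ordinal lt_a)).
  apply: tperm_iso_model => /= [u|u v|]; last by mleE => /=; split; lia.
  - by case/codeP => [{}u lt_u||]; rewrite ?eqxx //; mleE => /= *; split; lia.
  - by case/codeP => [{}u lt_u||]; rewrite ?eqxx // => /codeP[{}v lt_v||];
       rewrite ?eqxx //; mleE => //=; lia.
have [eY eb] : Y = a.+1 /\ b = a by move: cd; rewrite (negbTE neqXY); lia.
subst Y b; have lt_a : a < h.+2 by lia.
(* The former [y] is now the chain element [a], which lies below [x]; hence [xbot] grows to
   [a.+1]. *)
exists (Params X a.+1 a.+1 a false) => /=; first by case: eqVneq; lia.
exists (tperm (Ordinal lt_h1) (Ordinal lt_a)).
apply: tperm_iso_model => /= [u|u v|]; last by mleE => /=; split; lia.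
- by case/codeP => [{}u lt_u||]; rewrite ?eqxx //; mleE => /= *; split; lia.
- by case/codeP => [{}u lt_u||]; rewrite ?eqxx // => /codeP[{}v lt_v||];
     rewrite ?eqxx //; mleE => //=; lia.
Qed.

(** Level sizes are invariant and the chain contributes one element to each, so the two levels of
    [x] and [y] are determined as a multiset. In a reduced description [y] is never on the higher
    one, which fixes the order. *)
Lemma iso_model_levels d e t : reduced d -> reduced e ->
  iso_by (model h d) (model h e) t ->
  xtop d = xtop e /\ lev h d h.+1 = lev h e h.+1.
Proof.
move=> cd ce i.
have H l : (lev h d h == l) + (lev h d h.+1 == l) = (lev h e h == l) + (lev h e h.+1 == l).
  have : \sum_(u < h.+2) (lev h d u == l) = \sum_(u < h.+2) (lev h e u == l).
    rewrite [RHS](reindex_inj (@perm_inj _ t)); apply: eq_bigr => u _.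
    by rewrite (iso_model_lev u (reduced_valid cd) (reduced_valid ce) i).
  by rewrite !card_lev; lia.
have le_yx f : reduced f -> lev h f h.+1 <= lev h f h /\ 0 < xtop f.
  case: f {cd ce i H} => X a Y b r /=; rewrite lev_x lev_y /=.
  by case: r => /=; try case: ifP; lia.
have [[le_d dX] [le_e eX]] := (le_yx d cd, le_yx e ce).
have ex : lev h d h = lev h e h.
  have := H (lev h d h); rewrite eqxx; case: (eqVneq (lev h e h)) => // neq.
  case: eqVneq => // _; case: eqVneq => // e1 _.
  have := H (lev h e h); rewrite eqxx; case: eqVneq => // _.
  case: (eqVneq (lev h d h.+1)) => // e2; lia.
have ey : lev h d h.+1 = lev h e h.+1.
  by have := H (lev h d h.+1); rewrite ex eqxx; case: (eqVneq (lev h e h.+1)); lia.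
by rewrite !lev_x in ex; lia.
Qed.

End ReducedModels.

(** * Isomorphisms between normal forms *)

Section Isomorphisms.
Variable h : nat.
Implicit Types (d e : params) (u v : nat) (t : {perm 'I_h.+2}).

Definition code u : 'I_h.+2 := inord u.

Lemma val_code u : u < h.+2 -> code u = u :> nat.
Proof. exact: inordK. Qed.

(** The image of [u] stays on its level, hence is the chain element there, or else [x] or [y] if
    that one lies on this level. *)
Lemma iso_model_code d e t u : reduced h d -> reduced h e ->
  iso_by (model h d) (model h e) t -> u < h.+2 ->
  \sum_(v < h.+2) mle h d v u = \sum_(v < h.+2) mle h e v (t (code u)) /\
  [\/ t (code u) = lev h d u :> nat,
      t (code u) = h :> nat /\ (xtop e).-1 = lev h d u |
      t (code u) = h.+1 :> nat /\ lev h e h.+1 = lev h d u].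
Proof.
move=> cd ce i lt_u; split.
  by rewrite -(iso_model_down (code u) i) val_code.
have := iso_model_lev (code u) (reduced_valid cd) (reduced_valid ce) i.
rewrite val_code // => <-.
case: (codeP (ltn_ord (t (code u)))) => [v lt_v||].
- by constructor 1; rewrite lev_c.
- by constructor 2; rewrite lev_x.
- by constructor 3.
Qed.

Lemma perm_code_neq t u v : u < h.+2 -> v < h.+2 -> u != v ->
  t (code u) != t (code v) :> nat.
Proof.
by move=> lt_u lt_v neq_uv; rewrite val_eqE (inj_eq perm_inj) -val_eqE /= !val_code.
Qed.

Lemma iso_model_mle d e t u v : u < h.+2 -> v < h.+2 ->
  iso_by (model h d) (model h e) t ->
  mle h d u v = mle h e (t (code u)) (t (code v)).
Proof. by move=> lt_u lt_v /(_ (code u) (code v)); rewrite !leR_model !val_code. Qed.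

(* The excluded cases are those in which [x] or [y] can be exchanged with an
   element of its level, or, if [y < x] and [X = Y], the pairs [(y, x)] and
   [(X.-2, X.-1)] can be exchanged. *)
Definition asymmetric d : bool :=
  let: Params X a Y b r := d in
  if r then if X == Y then (a.+2 != X) || (b.+2 != X)
            else (a.+1 != X) && ((b.+1 != Y) || (a < Y))
  else if X == Y then a < b < Y.-1 else (b.+1 != Y) || (Y <= a).

(* The three elements of the level are told apart by their down-sets. *)
Lemma iso_one_level d e t : reduced h d -> reduced h e ->
  iso_by (model h d) (model h e) t -> lev h d h.+1 = (xtop d).-1 ->
  d = e /\ (asymmetric d -> t (code h) = h :> nat /\ t (code h.+1) = h.+1 :> nat
              /\ t (code (xtop d).-1) = (xtop d).-1 :> nat).
Proof.
move=> cd ce i; have [eX eY] := iso_model_levels cd ce i; move=> ey'.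
have ey : lev h e h.+1 = (xtop d).-1 by rewrite -eY.
have lt_h : h < h.+2 by []. have lt_h1 : h.+1 < h.+2 by [].
have lt_X : (xtop d).-1 < h by rewrite -(lev_x h); apply: lev_lt (reduced_valid cd) _.
have lt_X2 : (xtop d).-1 < h.+2 by lia.
have [Dx Lx] := iso_model_code cd ce i lt_h.
have [Dy Ly] := iso_model_code cd ce i lt_h1.
have [Dc Lc] := iso_model_code cd ce i lt_X2.
have nxy := perm_code_neq t lt_h lt_h1 (negbT (ltn_eqF (ltnSn h))).
have nxc := perm_code_neq t lt_h lt_X2 (negbT (gtn_eqF lt_X)).
have nyc := perm_code_neq t lt_h1 lt_X2 (negbT (gtn_eqF (leqW lt_X))).
case: d e => [X a Y b r] [X' a' Y' b' r'] /= in cd ce i eX eY ey ey' lt_X lt_X2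
  Dx Lx Dy Ly Dc Lc nxy nxc nyc *; subst X'.
have [rF eXY] : r = false /\ Y = X.
  by move: cd ey'; clear; rewrite !lev_y /=; case: r => /=; try case: eqVneq; lia.
have [rF' eXY'] : r' = false /\ Y' = X.
  by move: ce ey; clear; rewrite !lev_y /=; case: r' => /=; try case: eqVneq; lia.
subst r r' Y Y'; rewrite !eqxx in cd ce *.
rewrite !lev_y lev_x (lev_c _ lt_X) /= in Lx Ly Lc.
rewrite down_x /= in Dx; last lia.
rewrite down_y /= in Dy; last lia.
rewrite down_c //= in Dc.
have DX : \sum_(v < h.+2) mle h (Params X a' X b' false) v h = a'.+1.
  by rewrite down_x /=; lia.
have DY : \sum_(v < h.+2) mle h (Params X a' X b' false) v h.+1 = b'.+1.
  by rewrite down_y /=; lia.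
have DC : \sum_(v < h.+2) mle h (Params X a' X b' false) v X.-1 = X.
  by rewrite down_c //=; lia.
suff [-> -> H] : [/\ a = a', b = b' & a < b < X.-1 ->
    t (code h) = h :> nat /\ t (code h.+1) = h.+1 :> nat /\ t (code X.-1) = X.-1 :> nat].
  by split.
move: (t (code h) : nat) (t (code h.+1) : nat) (t (code X.-1) : nat)
  nxy nxc nyc Lx Ly Lc Dx Dy Dc => tx ty tc nxy nxc nyc Lx Ly Lc Dx Dy Dc.
clear i eY ey ey'.
(* The non-injective assignments are discarded. For the others the down-set sizes
   [a.+1 <= b.+1 <= X] of [d] are those of [e] up to order, hence equal; strict inequalities leave
   only the identity. *)
by case: Lx => [ex|[ex _]|[ex _]]; case: Ly => [ey|[ey _]|[ey _]];
   case: Lc => [ec|[ec _]|[ec _]]; subst tx ty tc; rewrite ?eqxx // in nxy nxc nyc;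
   rewrite ?DX ?DY ?DC in Dx Dy Dc; split; lia.
Qed.

Lemma reduced_bot d : reduced h d -> xbot d <= h /\ ybot d <= h.
Proof. by case: d => X a Y b r /=; lia. Qed.

(** The shapes of a normal form with [y] on a lower level than [x]. Indexing by the levels [i] of
    [x] and [j] of [y] rids the case analysis of predecessors. *)
Variant two_levels_spec i j : params -> Prop :=
  | TwoLevelsMatching a b of b <= a <= j & i = j.+1 :
      two_levels_spec i j (Params i.+1 a i.+1 b true)
  | TwoLevelsOver a b of b <= a <= i & b <= j & ~~ ((a == j) && (b == j)) :
      two_levels_spec i j (Params i.+1 a j.+1 b true)
  | TwoLevelsApart a b of a <= j.+1 & b <= j :
      two_levels_spec i j (Params i.+1 a j.+1 b false).

Lemma two_levelsP d : reduced h d -> lev h d h.+1 < (xtop d).-1 ->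
  two_levels_spec (xtop d).-1 (lev h d h.+1) d.
Proof.
case: d => X a Y b r /=; rewrite lev_y /=.
case: X => [|i] /=; first lia.
case: r => /=; last first.
  case: eqVneq => [<-|neq] /=; first lia.
  by case: Y neq => [|j] /= *; [lia | constructor; lia].
case: eqVneq => [<-|neq] /=; first by constructor; lia.
by case: Y neq => [|j] /= *; [lia | constructor; lia].
Qed.

(* The two elements of either level are told apart by their down-sets, up to the
   order relations between the two levels. *)
Lemma iso_two_levels d e t (i := (xtop d).-1) (j := lev h d h.+1) :
  reduced h d -> reduced h e -> iso_by (model h d) (model h e) t -> j < i ->
  d = e /\ (asymmetric d -> [/\ t (code h) = h :> nat, t (code h.+1) = h.+1 :> nat,
               t (code i) = i :> nat & t (code j) = j :> nat]).
Proof.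
move=> cd ce iso lt_ji; have [eX eY] := iso_model_levels cd ce iso.
have lt_h : h < h.+2 by []. have lt_h1 : h.+1 < h.+2 by [].
have lt_i : i < h by rewrite /i -(lev_x h); apply: lev_lt (reduced_valid cd) _.
have lt_j : j < h by apply: ltn_trans lt_i.
have lt_i2 : i < h.+2 by lia. have lt_j2 : j < h.+2 by lia.
have [Dx Lx] := iso_model_code cd ce iso lt_h.
have [Dy Ly] := iso_model_code cd ce iso lt_h1.
have [Di Li] := iso_model_code cd ce iso lt_i2.
have [Dj Lj] := iso_model_code cd ce iso lt_j2.
have nxi := perm_code_neq t lt_h lt_i2 (negbT (gtn_eqF lt_i)).
have nyj := perm_code_neq t lt_h1 lt_j2 (negbT (gtn_eqF (leqW lt_j))).
have Myx := iso_model_mle lt_h1 lt_h iso.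
have Myi := iso_model_mle lt_h1 lt_i2 iso.
have Mjx := iso_model_mle lt_j2 lt_h iso.
rewrite -eY -eX lev_x (lev_c _ lt_i) (lev_c _ lt_j) -/i -/j in Lx Ly Li Lj.
rewrite down_c // in Di; rewrite down_c // in Dj.
rewrite mle_yx in Myx; rewrite mle_yc // in Myi; rewrite mle_cx // in Mjx.
have ei : i = (xtop d).-1 by [].
have ejd : j = lev h d h.+1 by []. have eje : j = lev h e h.+1 by rewrite -eY.
clear eY; move: i j lt_ji ei ejd eje lt_i lt_j {lt_i2 lt_j2} Dx Lx Dy Ly Di Li Dj Lj
  nxi nyj Myx Myi Mjx => i j lt_ji ei ejd eje lt_i lt_j.
move: (t (code h) : nat) (t (code h.+1) : nat) (t (code i) : nat) (t (code j) : nat).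
move=> tx ty ti tj Dx Lx Dy Ly Di Li Dj Lj nxi nyj Myx Myi Mjx.
(* Since [j < i], the two levels are the disjoint pairs of [x] with [i] and of [y] with [j], and [t]
   either keeps or exchanges the names in each. *)
have Lxi : (tx = i /\ ti = h) \/ (tx = h /\ ti = i).
  by move: Lx Li nxi lt_ji; clear; case=> [L|[L L']|[L L']] [M|[M M']|[M M']]; lia.
have Lyj : (ty = j /\ tj = h.+1) \/ (ty = h.+1 /\ tj = j).
  by move: Ly Lj nyj lt_ji; clear; case=> [L|[L L']|[L L']] [M|[M M']|[M M']]; lia.
clear Lx Ly Li Lj nxi nyj.
have [[dx dy] [ex ey]] := (reduced_bot cd, reduced_bot ce).
have Sd : two_levels_spec i j d.
  by move: cd lt_ji; rewrite ejd ei; apply: two_levelsP.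
have Se : two_levels_spec i j e.
  by move: ce lt_ji; rewrite eje ei eX; apply: two_levelsP.
have DXe := down_x ex; have DYe := down_y ey.
have DIe := @down_c h e i lt_i; have DJe := @down_c h e j lt_j.
have Eyx := mle_yx h e; have Eyi := mle_yc e lt_i; have Ejx := mle_cx e lt_j.
have Eji := mle_cc e lt_j lt_i.
rewrite down_x // in Dx; rewrite down_y // in Dy.
suff [E H] : d = e /\ (asymmetric d -> [/\ tx = h, ty = h.+1, ti = i & tj = j]) by [].
move: Myx Myi Mjx Dx Dy Di Dj.
(* For each of the four actions of [t] and each pair of shapes, the recorded relations and down-set
   sizes are contradictory or force equal parameters; asymmetry then rules out the exchanges. *)
case: Lxi Lyj => -[-> ->] [] [-> ->]; rewrite ?DXe ?DYe ?DIe ?DJe ?Eyx ?Eyi ?Ejx ?Eji;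
clear -Sd Se lt_ji;
have [ii ji ij jj] : [/\ i.+1 <= i = false, j.+1 <= i, i.+1 <= j = false & j.+1 <= j = false]
  by split; lia.
all: case: Sd => [a b ab Hij|a b ab bj nab|a b aj bj];
  case: Se => [a' b' ab' Hij'|a' b' ab' bj' nab'|a' b' aj' bj'] /=;
  rewrite ?(ii, ji, ij, jj, eqxx, eqSS, (gtn_eqF lt_ji)) /= => *.
all: try by exfalso; lia.
all: by split=> [|?]; [congr Params; lia | split; lia].
Qed.

End Isomorphisms.

(** * Automorphisms of normal forms *)

Section Rigidity.
Variable h : nat.
Implicit Types (d e : params) (u v : nat) (t : {perm 'I_h.+2}).

Lemma reduced_lev_y d : reduced h d -> lev h d h.+1 <= (xtop d).-1.
Proof.
by case: d => X a Y b r /=; rewrite lev_y /=; case: r => /=; try case: ifP; lia.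
Qed.

Lemma reduced_iso_eq d e : reduced h d -> reduced h e ->
  iso_posets (model h d) (model h e) -> d = e.
Proof.
move=> cd ce /iso_posetsP[t i].
have := reduced_lev_y cd; rewrite leq_eqVlt => /orP[/eqP ey|lt_y].
  by case: (iso_one_level cd ce i ey).
by case: (iso_two_levels cd ce i lt_y).
Qed.

Lemma asymmetric_rigid d : reduced h d -> asymmetric d -> rigid (model h d).
Proof.
move=> cd ad t /is_autP i; apply/permP => u; rewrite perm1; apply: val_inj.
have [tx ty ti tj] : [/\ t (code h h) = h :> nat, t (code h h.+1) = h.+1 :> nat,
   t (code h (xtop d).-1) = (xtop d).-1 :> nat &
   t (code h (lev h d h.+1)) = lev h d h.+1 :> nat].
  have := reduced_lev_y cd; rewrite leq_eqVlt => /orP[/eqP ey|lt_y].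
    by have [_ /(_ ad) [? [? ?]]] := iso_one_level cd cd i ey; rewrite !ey.
  by have [_ /(_ ad)] := iso_two_levels cd cd i lt_y.
have E v : v = u :> nat -> code h v = u by move=> ->; rewrite /code inord_val.
have [lt_u|ge_u] := ltnP u h; last first.
  have [/esym e|/esym e] : u = h :> nat \/ u = h.+1 :> nat by have := ltn_ord u; lia.
    by rewrite (E _ e) in tx; rewrite /= tx.
  by rewrite (E _ e) in ty; rewrite /= ty.
(* A chain element [u] that is not kept would have to go to [x] or [y], hence be the chain element
   of that level; but this one is already known to be fixed. *)
have [_] := iso_model_code cd cd i (ltn_ord u); rewrite E // lev_c //.
by case=> // -[_ e]; [rewrite (E _ e) e in ti | rewrite (E _ e) e in tj].
Qed.

Lemma Sigma_tperm (T : finType) (i j : T) : i != j -> Sigma (tperm i j) = [set i; j].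
Proof.
move=> neq_ij; apply/setP => u; rewrite !inE.
case: tpermP => [->|->|/eqP ui /eqP uj].
- by rewrite eqxx eq_sym.
- by rewrite eqxx orbT.
- by rewrite eqxx (negbTE ui) (negbTE uj).
Qed.

(** Two elements of the same level are incomparable, so a singleton is a longest chain among the
    moved elements. *)
Lemma tperm_chain_swap d (i j : 'I_h.+2) : valid h d -> i != j ->
  lev h d i = lev h d j -> iso_by (model h d) (model h d) (tperm i j) ->
  chain_swap (model h d) (tperm i j) [set i].
Proof.
move=> vd neq_ij eq_lev i_ij; split; last first.
  move=> K; rewrite Sigma_tperm // => /subsetP sK cK.
  rewrite cards1 -(cards1 (Ordinal (lev_lt vd (ltn_ord i)))).
  apply: (chain_card_lev vd cK) => u /sK; rewrite !inE.
  by case/orP=> /eqP ->; exists (Ordinal (lev_lt vd (ltn_ord i))); rewrite ?inE.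
have im : tperm i j @: [set i] = [set j] by rewrite imset_set1 tpermL.
split.
- exact/is_autP.
- exact: tpermK.
- apply/chainP => u v /set1P -> /set1P ->.
  by case/posetP: (model_poset vd) => ->.
- by rewrite im Sigma_tperm.
- by rewrite im (inj_eq set1_inj) eq_sym.
Qed.

Lemma tperm_aut_model d (i j : 'I_h.+2) : valid h d ->
  (forall u, u < h.+2 -> u != i -> u != j ->
     mle h d u i = mle h d u j /\ mle h d i u = mle h d j u) ->
  mle h d i j = mle h d j i ->
  iso_by (model h d) (model h d) (tperm i j).
Proof.
move=> vd H eij; apply: tperm_iso_model => // [u lt_u ui uj|].
  by have [-> ->] := H u lt_u ui uj.
by case/posetP: (model_poset vd) => rR _ _; rewrite -!leR_model !rR !leR_model.
Qed.

(** Here [y < x] and [j < j.+1] are two parallel chains with the same elements above and below them;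
    [s] exchanges them. The moved elements occupy only two levels, so no chain among them is
    longer. *)
Lemma double_chain_swap j (d := Params j.+2 j j.+2 j true) : valid h d ->
  exists s C, chain_swap (model h d) s C.
Proof.
move=> vd.
have lt_jh : j.+1 < h by move: vd => /=; lia.
have lt_j : j < h.+2 by lia. have lt_i : j.+1 < h.+2 by lia.
have lt_h : h < h.+2 by []. have lt_h1 : h.+1 < h.+2 by [].
pose oj := Ordinal lt_j; pose oi := Ordinal lt_i.
pose ox := Ordinal lt_h; pose oy := Ordinal lt_h1.
pose s := (tperm ox oi * tperm oy oj)%g.
have sx : s ox = oi by rewrite permM tpermL tpermD //; rewrite -val_eqE /=; lia.
have si : s oi = ox by rewrite permM tpermR tpermD //; rewrite -val_eqE /=; lia.
have sy : s oy = oj by rewrite permM (@tpermD _ ox oi) ?tpermL //; rewrite -val_eqE /=; lia.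
have sj : s oj = oy by rewrite permM (@tpermD _ ox oi) ?tpermR //; rewrite -val_eqE /=; lia.
have so (u : 'I_h.+2) : u != ox -> u != oi -> u != oy -> u != oj -> s u = u.
  by move=> ux ui uy uj; rewrite permM !tpermD // eq_sym.
have cases (u : 'I_h.+2) :
  [\/ u = ox, u = oi, u = oy | u = oj] \/
  [/\ u < h, u != j :> nat, u != j.+1 :> nat & s u = u].
  have [->|ux] := eqVneq u ox; first by left; constructor 1.
  have [->|ui] := eqVneq u oi; first by left; constructor 2.
  have [->|uy] := eqVneq u oy; first by left; constructor 3.
  have [->|uj] := eqVneq u oj; first by left; constructor 4.
  right; split; rewrite ?so //.
  by move: ux uy; rewrite -!val_eqE /=; have := ltn_ord u; lia.
have sigE : Sigma s = [set ox; oi; oy; oj].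
  apply/setP => u; rewrite !inE; case: (cases u) => [[]->|[lt_u uj ui ->]].
  - by rewrite sx eqxx -val_eqE /=; lia.
  - by rewrite si eqxx -val_eqE /=; lia.
  - by rewrite sy eqxx -val_eqE /=; lia.
  - by rewrite sj eqxx -val_eqE /=; lia.
  - by rewrite -!val_eqE /=; lia.
have im : s @: [set oy; ox] = [set oj; oi].
  by rewrite imsetU1 imset_set1 sx sy.
exists s, [set oy; ox]; split; last first.
  move=> K; rewrite sigE => /subsetP sK cK.
  have lt_j' : j < h by lia.
  rewrite [#|[set _; _]|](_ : _ = #|[set Ordinal lt_j'; Ordinal lt_jh]|); last first.
    by rewrite !cards2 -!val_eqE /=; lia.
  apply: (chain_card_lev vd cK) => u /sK; rewrite !inE.
  case/orP => [/orP[/orP[]|]|] /eqP ->.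
  - by exists (Ordinal lt_jh); rewrite ?inE ?eqxx ?orbT // lev_x.
  - by exists (Ordinal lt_jh); rewrite ?inE ?eqxx ?orbT // lev_c.
  - by exists (Ordinal lt_j'); rewrite ?inE ?eqxx ?orbT // lev_y /= eqxx.
  - by exists (Ordinal lt_j'); rewrite ?inE ?eqxx ?orbT // lev_c.
split.
- apply/is_autP => u v; rewrite !leR_model.
  by case: (cases u) => [[]->|[lt_u uj ui ->]]; case: (cases v) => [[]->|[lt_v vj vi ->]];
  rewrite ?sx ?si ?sy ?sj /=; mleE => //=; lia.
- by move=> u; case: (cases u) => [[]->|[_ _ _ e]]; rewrite ?sx ?si ?sy ?sj ?e.
- apply/chainP => u v; rewrite !inE => /orP[]/eqP-> /orP[]/eqP->;
  by rewrite !leR_model /=; mleE.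
- by rewrite im sigE; apply/setP => u; rewrite !inE; 
  case: (u == ox); case: (u == oi); case: (u == oy); case: (u == oj).
- rewrite im; apply/eqP => /setP/(_ ox); rewrite !inE -!val_eqE /=; lia.
Qed.

Lemma symmetric_chain_swap d : reduced h d -> ~~ asymmetric d ->
  exists s C, chain_swap (model h d) s C.
Proof.
move=> cd; have vd := reduced_valid cd.
have lt_h : h < h.+2 by []. have lt_h1 : h.+1 < h.+2 by [].
have lt_X : (xtop d).-1 < h by rewrite -(lev_x h); apply: lev_lt.
have lt_J : lev h d h.+1 < h by apply: lev_lt.
have lt_X2 : (xtop d).-1 < h.+2 by lia.
have lt_J2 : lev h d h.+1 < h.+2 by lia.
have := reduced_lev_y cd; rewrite leq_eqVlt => /orP[/eqP ey|lt_y].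
  case: d cd vd ey lt_X lt_J lt_X2 lt_J2 => X a Y b r cd vd ey lt_X lt_J lt_X2 lt_J2.
  have [rF eXY] : r = false /\ Y = X.
    by move: cd ey; clear; rewrite !lev_y /=; case: r => /=; try case: eqVneq; lia.
  subst r Y; move: (cd); rewrite /= eqxx => cd' nad.
  (* With [a = b] the elements [x] and [y] are twins; with [b = X.-1] the twins are [y] and the
     chain element [X.-1]. *)
  have [eab|eb] : a = b \/ b = X.-1 by lia.
    exists (tperm (Ordinal lt_h) (Ordinal lt_h1)), [set (Ordinal lt_h)].
    apply: tperm_chain_swap => //; first by rewrite -val_eqE /=; lia.
      by rewrite /= lev_x ey.
    apply: tperm_aut_model => //= [u|].
      by case/codeP=> [{}u lt_u||]; rewrite ?eqxx //; mleE => /= *; split; lia.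
    by mleE.
  exists (tperm (Ordinal lt_h1) (Ordinal lt_X2)), [set (Ordinal lt_h1)].
  apply: tperm_chain_swap => //; first by rewrite -val_eqE /=; lia.
    by rewrite /= ey lev_c.
  apply: tperm_aut_model => //= [u|].
    by case/codeP=> [{}u lt_u||]; rewrite ?eqxx //; mleE => /= *; split; lia.
  by rewrite /= in lt_X; mleE => /=; lia.
have [i ei] : {i | i = (xtop d).-1} by exists (xtop d).-1.
have [j ej] : {j | j = lev h d h.+1} by exists (lev h d h.+1).
have lx : lev h d h = i by rewrite lev_x.
have := two_levelsP cd lt_y; rewrite -ei -ej in lt_X lt_J lt_X2 lt_J2 lt_y * => Sd.
have aut_x : (forall u, u < h.+2 -> u != h -> u != i ->
     mle h d u h = mle h d u i /\ mle h d h u = mle h d i u) ->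
  mle h d h i = mle h d i h -> exists s C, chain_swap (model h d) s C.
  move=> H1 H2; exists (tperm (Ordinal lt_h) (Ordinal lt_X2)), [set (Ordinal lt_h)].
  apply: tperm_chain_swap; rewrite /= ?lx ?lev_c -?val_eqE //=; first lia.
  exact: tperm_aut_model.
have aut_y : (forall u, u < h.+2 -> u != h.+1 -> u != j ->
     mle h d u h.+1 = mle h d u j /\ mle h d h.+1 u = mle h d j u) ->
  mle h d h.+1 j = mle h d j h.+1 -> exists s C, chain_swap (model h d) s C.
  move=> H1 H2; exists (tperm (Ordinal lt_h1) (Ordinal lt_J2)), [set (Ordinal lt_h1)].
  apply: tperm_chain_swap; rewrite /= -?ej ?lev_c -?val_eqE //=; first lia.
  exact: tperm_aut_model.
clear cd ei ej lx.
(* The matching shape needs the double exchange. Otherwise failing asymmetry makes [x] a twin of [i]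
   when [a = i], or [y] a twin of [j] when [b = j] and [x] is above both or neither of them. *)
case: Sd vd aut_x aut_y => [a b ab eij|a b ab bj nab|a b aj bj] vd aut_x aut_y /= nad.
- rewrite eqxx in nad; have [ea eb] : a = j /\ b = j by lia.
  by subst a b i; apply: double_chain_swap.
- rewrite eqSS (gtn_eqF lt_y) in nad.
  have [eai|[ebj lt_ja]] : a = i \/ b = j /\ j < a by lia.
    apply: aut_x; last by mleE => /=; lia.
    by move=> u /codeP[{}u lt_u||]; rewrite ?eqxx //; mleE => /= *; split; lia.
  apply: aut_y; last by mleE => /=; lia.
  by move=> u /codeP[{}u lt_u||]; rewrite ?eqxx //; mleE => /= *; split; lia.
- rewrite eqSS (gtn_eqF lt_y) in nad.
  apply: aut_y; last by mleE => /=; lia.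
  by move=> u /codeP[{}u lt_u||]; rewrite ?eqxx //; mleE => /= *; split; lia.
Qed.

End Rigidity.

(** * Existence of the normal form *)

Section ChainPosition.
Variables (T : finType) (R : {set T * T}) (C : {set T}).
Hypotheses (pR : is_poset R) (cC : is_chain R C).

Definition pos (c : T) : nat := #|[set x in C | ltR R x c]|.

(** Initial segments of a chain are nested, so sizes decide: if [c] is in [D], the elements before
    [c] form a proper subset of [D]; otherwise they include [D]. *)
Lemma pos_down (D : {set T}) (c : T) : D \subset C ->
  (forall x y, x \in C -> y \in D -> ltR R x y -> x \in D) ->
  c \in C -> (c \in D) = (pos c < #|D|).
Proof.
move=> sDC downD cC'; have /chainP totC := cC.
apply/idP/idP => [cD|]; last apply: contraTT => cND.
  apply/proper_card/properP; split.
    by apply/subsetP => x; rewrite inE => /andP[xC /downD]; apply.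
  by exists c; rewrite // inE /ltR eqxx !andbF.
rewrite -leqNgt; apply/subset_leq_card/subsetP => x xD.
have xC := subsetP sDC x xD; rewrite inE xC /ltR.
have neq_xc : x != c by apply: contraNneq cND => <-.
rewrite neq_xc andbT; have /orP[//|le_cx] := totC x c xC cC'.
by case/negP: cND; apply: (downD c x) => //; rewrite /ltR le_cx eq_sym.
Qed.

Lemma pos_lt c : c \in C -> pos c < #|C|.
Proof. by move=> cC'; rewrite -pos_down. Qed.

Lemma ltR_pos c c' : c \in C -> c' \in C -> ltR R c c' = (pos c < pos c').
Proof.
case/posetP: pR => rR aR tR; move=> cC1 cC2; rewrite -pos_down //.
- by rewrite inE cC1.
- by apply/subsetP => x; rewrite inE => /andP[].
- move=> x y xC; rewrite !inE xC => /andP[_ /andP[yc neq]] /andP[xy _] /=.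
  rewrite /ltR (tR _ _ _ xy yc); apply: contraNneq neq => e.
  by apply/eqP/aR; rewrite yc -e xy.
Qed.

Lemma leR_pos c c' : c \in C -> c' \in C -> leR R c c' = (pos c <= pos c').
Proof.
case/posetP: pR => rR aR _; move=> cC1 cC2; rewrite leqNgt -ltR_pos // /ltR.
have [->|neq] := eqVneq c' c; first by rewrite andbF rR.
rewrite andbT; have /chainP/(_ c c' cC1 cC2) := cC.
case le1: (leR R c c'); case le2: (leR R c' c) => //= _.
by case/eqP: neq; apply: aR; rewrite le1 le2.
Qed.

End ChainPosition.

Section Existence.
Variable h : nat.
Implicit Types (d : params).

Lemma model_valid d : is_poset (model h d) -> height (model h d) <= h ->
  xbot d <= h -> ybot d <= h -> xtop d <= h -> ytop d <= h -> valid h d.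
Proof.
case: d => X a Y b r /= /posetP[_ _ trR] le_h a_h b_h X_h Y_h.
set d := Params X a Y b r in trR le_h *.
have tr u v w : u < h.+2 -> v < h.+2 -> w < h.+2 -> mle h d u v -> mle h d v w -> mle h d u w.
  move=> lt_u lt_v lt_w.
  by have := trR (Ordinal lt_v) (Ordinal lt_u) (Ordinal lt_w); rewrite !leR_model.
(* Height at most [h] prevents the [h.+1] elements other than [w] from forming a chain. *)
have no_chain w : w < h.+2 ->
    ~ (forall u v, u < h.+2 -> v < h.+2 -> u != w -> v != w -> mle h d u v || mle h d v u).
  move=> lt_w H; suff: h.+1 <= height (model h d) by rewrite ltnNge le_h.
  have cardw : #|~: [set Ordinal lt_w]| = h.+1 by rewrite cardsC1 card_ord.
  apply: leq_trans (eq_leq (esym cardw)) _.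
  apply: card_chain_ell; first exact: subsetT.
  by apply/chainP => u v; rewrite !inE -!val_eqE !leR_model => *; apply: H.
have aX : a < X.
  rewrite ltnNge; apply/negP => Xa; apply: (no_chain h.+1) => // u v.
  by case/codeP=> [{}u lt_u||] /codeP[{}v lt_v||]; rewrite ?eqxx //; mleE => //=; lia.
have bY : b < Y.
  rewrite ltnNge; apply/negP => Xa; apply: (no_chain h) => // u v.
  by case/codeP=> [{}u lt_u||] /codeP[{}v lt_v||]; rewrite ?eqxx //; mleE => //=; lia.
rewrite aX bY X_h Y_h /=; case: (boolP r) => [rT|rF].
  have ba : b <= a.
    rewrite leqNgt; apply/negP => ab.
    have := tr a h.+1 h; mleE => /=; lia.
  have YX : Y <= X.
    rewrite leqNgt; apply/negP => XY.
    have := tr h.+1 h X; mleE => /=; lia.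
  (* If [X <= b.+1], all elements other than [b] form a chain passing through [y < x]. *)
  rewrite ba YX ltnNge; apply/negP => Xb; apply: (no_chain b); first lia.
  by move=> u v; case/codeP=> [{}u lt_u||] /codeP[{}v lt_v||]; mleE => //=; lia.
apply/andP; split; rewrite leqNgt; apply/negP => lt.
  have := tr h.+1 Y h; mleE => /=; lia.
have := tr h X h.+1; mleE => /=; lia.
Qed.

Lemma exists_model (R : {set 'I_h.+2 * 'I_h.+2}) : is_poset R -> height R = h ->
  exists2 d, valid h d & iso_posets (model h d) R.
Proof.
move=> pR hR; have [C cC cardC] := exists_longest_chain R; rewrite hR in cardC.
have [rR aR tR] := posetP _ pR.
have : #|~: C| = 2 by have := cardsC C; rewrite card_ord cardC; lia.
move/eqP/cards2P => [x [y [neq_xy eC]]].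
(* By antisymmetry at most one of [x <= y], [y <= x] holds; the names are chosen so that only
   [y < x] can occur. *)
wlog nxy : x y neq_xy eC / ~~ leR R x y.
  move=> H; case xy : (leR R x y); last by apply: (H x y) => //; rewrite xy.
  apply: (H y x); rewrite 1?eq_sym // 1?setUC //.
  by apply: contra neq_xy => yx; apply/eqP/aR; rewrite xy yx.
have inC u : (u \in C) = (u != x) && (u != y).
  by rewrite -[u \in C]negbK -in_setC eC !inE negb_or.
(* Both sets are closed downwards in [C], so by [pos_down] each is an initial segment given by its
   size. [NTop] collects the elements not above [z], so that its size is the position where the
   elements above [z] begin. *)
pose Bot z := [set c in C | ltR R c z]; pose NTop z := [set c in C | ~~ leR R z c].
have BotE z c : c \in C -> (ltR R c z) = (pos R C c < #|Bot z|).
  move=> cC'; rewrite -(pos_down cC) ?inE ?cC' //.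
    by apply/subsetP => u; rewrite inE => /andP[].
  move=> u v uC; rewrite !inE uC => /andP[_ /andP[vz neq]] /andP[uv neq_uv] /=.
  rewrite /ltR (tR _ _ _ uv vz) /=; apply: contraNneq neq => e.
  by apply/eqP/aR; rewrite vz -e uv.
have NTopE z c : c \in C -> leR R z c = (#|NTop z| <= pos R C c).
  move=> cC'; rewrite leqNgt -(pos_down cC) ?inE ?cC' ?negbK //.
    by apply/subsetP => u; rewrite inE => /andP[].
  move=> u v uC; rewrite !inE uC => /andP[_ nzv] /andP[uv _] /=.
  by apply: contra nzv => zu; apply: tR zu uv.
have sub_h (D : {set 'I_h.+2}) : D \subset C -> #|D| <= h.
  by move/subset_leq_card; rewrite cardC.
have Bot_h z : #|Bot z| <= h by apply/sub_h/subsetP => u; rewrite inE => /andP[].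
have NTop_h z : #|NTop z| <= h by apply/sub_h/subsetP => u; rewrite inE => /andP[].
pose d := Params #|NTop x| #|Bot x| #|NTop y| #|Bot y| (leR R y x).
pose f (u : 'I_h.+2) : nat := if u \in C then pos R C u else if u == x then h else h.+1.
have pos_h u : u \in C -> pos R C u < h by move/(pos_lt cC); rewrite cardC.
have f_lt u : f u < h.+2.
  by rewrite /f; case: ifP => [/pos_h|_]; [lia | case: ifP].
have fx : f x = h by rewrite /f inC eqxx.
have fy : f y = h.+1 by rewrite /f inC eqxx andbF eq_sym (negbTE neq_xy).
have fc u : u \in C -> f u = pos R C u by rewrite /f => ->.
have cases u : [\/ u = x, u = y | u \in C].
  rewrite inC; have [->|_] := eqVneq u x; first by constructor 1.
  by have [->|_] := eqVneq u y; [constructor 2 | constructor 3].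
have neqC u z : u \in C -> z \notin C -> u != z by move=> uC; apply: contraNneq => <-.
have xNC : x \notin C by rewrite inC eqxx.
have yNC : y \notin C by rewrite inC eqxx andbF.
have ltC u z : u \in C -> z \notin C -> leR R u z = ltR R u z.
  by move=> uC zC; rewrite /ltR neqC ?andbT.
have f_iso u v : leR R u v = mle h d (f u) (f v).
  case: (cases u) => [->|->|uC]; case: (cases v) => [->|->|vC]; rewrite ?fx ?fy ?fc //.
  - by rewrite mle_xx rR.
  - by rewrite mle_xy (negbTE nxy).
  - by rewrite mle_xc ?pos_h ?NTopE.
  - by rewrite mle_yx.
  - by rewrite mle_yy rR.
  - by rewrite mle_yc ?pos_h ?NTopE.
  - by rewrite mle_cx ?pos_h // ltC ?BotE.
  - by rewrite mle_cy ?pos_h // ltC ?BotE.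
  - by rewrite mle_cc ?pos_h // (leR_pos pR cC).
pose g u : 'I_h.+2 := Ordinal (f_lt u).
have g_inj : injective g.
  move=> u v /(congr1 val) /= e; apply: aR.
  by rewrite !f_iso e -f_iso rR.
have i : iso_by R (model h d) (perm g_inj).
  by move=> u v; rewrite leR_model !permE /= f_iso.
exists d; last by apply/iso_posets_sym/iso_posetsP; exists (perm g_inj).
apply: model_valid => //=; first exact: iso_by_poset pR.
by rewrite -(iso_by_height i) hR.
Qed.

End Existence.

(** * Counting normal forms *)

Section Counting.

Definition coded_params h : finType :=
  ('I_h.+1 * 'I_h.+1 * 'I_h.+1 * 'I_h.+1 * bool)%type.

Definition decode h (z : coded_params h) : params :=
  let: (X, Y, a, b, r) := z in Params X a Y b r.

Lemma decode_inj h : injective (@decode h).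
Proof.
move=> [[[[X Y] a] b] r] [[[[X' Y'] a'] b'] r'] [eX ea eY eb ->].
by congr (_, _, _, _, _); apply: val_inj.
Qed.

Lemma decode_reduced h d : reduced h d -> exists z : coded_params h, decode z = d.
Proof.
case: d => X a Y b r /= rd.
exists (inord X, inord Y, inord a, inord b, r) => /=.
by rewrite !inordK //; lia.
Qed.

Lemma sum_ord_trunc m n (F : nat -> nat) : m <= n -> (forall i, m <= i -> F i = 0) ->
  \sum_(i < n) F i = \sum_(i < m) F i.
Proof.
move=> le_mn F0; rewrite (big_ord_widen n F le_mn) [RHS]big_mkcond /=.
by apply: eq_bigr => i _; case: ltnP => // /F0.
Qed.

Lemma double_sum_minn m k : 2 * \sum_(a < m + k) minn m a.+1 = m * m.+1 + 2 * m * k.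
Proof.
elim: k => [|k IHk]; last by rewrite addnS big_ord_recr /= mulnDr IHk; lia.
rewrite addn0 muln0 addn0 (eq_bigr (fun a : 'I_m => a.+1)) => [|a _]; last exact/minn_idPr/ltn_ord.
by elim: m => [|m IHm]; rewrite ?big_ord0 // big_ord_recr /= mulnDr IHm; lia.
Qed.

(** The bound [h] enters [reduced h] only through [X <= h], so [reduced X] can replace it; [a < X]
    and [b < Y] hold in every reduced description. *)
Definition pair_count (Q : params -> bool) X Y :=
  \sum_(a < X) \sum_(b < Y)
    ((reduced X (Params X a Y b true) && Q (Params X a Y b true)) +
     (reduced X (Params X a Y b false) && Q (Params X a Y b false))).

Lemma card_reduced h (Q : params -> bool) :
  #|[set z : coded_params h | reduced h (decode z) && Q (decode z)]| =
  \sum_(X < h.+1) \sum_(Y < X.+1) pair_count Q X Y.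
Proof.
pose F X Y a b r : nat := reduced X (Params X a Y b r) && Q (Params X a Y b r).
have -> : #|[set z : coded_params h | reduced h (decode z) && Q (decode z)]| =
  \sum_(X < h.+1) \sum_(Y < h.+1) \sum_(a < h.+1) \sum_(b < h.+1)
    (F X Y a b true + F X Y a b false).
  rewrite -sum1_card big_mkcond /= pair_bigA pair_bigA pair_bigA /=.
  transitivity (\sum_(z : coded_params h) F z.1.1.1.1 z.1.1.1.2 z.1.1.2 z.1.2 z.2).
    apply: eq_bigr => -[[[[X Y] a] b] r] _; rewrite inE /F /=.
    have -> : (Y <= X <= h) = (Y <= X <= X) by have := ltn_ord X; lia.
    by case: (_ && Q _).
  rewrite -(pair_bigA _ (fun (z : 'I_h.+1 * 'I_h.+1 * 'I_h.+1 * 'I_h.+1) r =>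
     F z.1.1.1 z.1.1.2 z.1.2 z.2 r)) /=.
  by apply: eq_bigr => z _; rewrite big_bool.
have F0 X Y a b r : (X < Y) || (X <= a) || (Y <= b) -> F X Y a b r = 0.
  by rewrite /F /= => H; case: (boolP (_ && Q _)) => //= /andP[]; lia.
apply: eq_bigr => X _; have lt_X := ltn_ord X.
rewrite (@sum_ord_trunc X.+1 h.+1 (fun Y => \sum_(a < h.+1) \sum_(b < h.+1)
   (F X Y a b true + F X Y a b false))) //; last first.
  by move=> Y lt_XY; rewrite big1 // => a _; rewrite big1 // => b _; rewrite !F0 ?lt_XY.
apply: eq_bigr => Y _; have lt_Y := ltn_ord Y.
rewrite (@sum_ord_trunc X h.+1 (fun a => \sum_(b < h.+1)
   (F X Y a b true + F X Y a b false))) ; last first.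
- by move=> a le_Xa; rewrite big1 // => b _; rewrite !F0 ?le_Xa ?orbT.
- exact: ltnW.
apply: eq_bigr => a _.
rewrite (@sum_ord_trunc Y h.+1 (fun b => F X Y a b true + F X Y a b false)) //; first lia.
by move=> b le_Yb; rewrite !F0 ?le_Yb ?orbT.
Qed.

Lemma pair_count0 Q X : pair_count Q X 0 = 0.
Proof. by rewrite /pair_count big1 // => a _; rewrite big_ord0. Qed.

(** With [y < x], each [a] allows [minn Y a.+1] values of [b], less the excluded [a = b = Y.-1];
    otherwise each [a <= Y] allows all [Y] values. *)
Lemma pair_count_all_lt X Y : 0 < Y < X ->
  2 * pair_count xpredT X Y + 2 = Y * Y + 3 * Y + 2 * X * Y.
Proof.
move=> ltYX.
have E : pair_count xpredT X Y + 1 =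
    \sum_(a < X) minn Y a.+1 + \sum_(a < X) Y * (a < Y.+1).
  have <- : \sum_(a < X) (a == Y.-1 :> nat) = 1 by rewrite sum_eq_ord; lia.
  rewrite -!big_split /=; apply: eq_bigr => a _; have lt_a := ltn_ord a.
  rewrite big_split /= addnAC; congr (_ + _).
    have [ea|na] := eqVneq (a : nat) Y.-1.
      rewrite (eq_bigr (fun b : 'I_Y => (b < a) : nat)) ?sum_ltn_ord; first lia.
      by move=> b _; have := ltn_ord b; case: eqVneq; lia.
    rewrite (eq_bigr (fun b : 'I_Y => (b < a.+1) : nat)) ?sum_ltn_ord; first lia.
    by move=> b _; have := ltn_ord b; case: eqVneq; lia.
  rewrite (eq_bigr (fun b : 'I_Y => (a < Y.+1) : nat)).
    by rewrite sum_nat_const card_ord.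
  by move=> b _; have := ltn_ord b; case: eqVneq; lia.
rewrite -big_distrr /= sum_ltn_ord (minn_idPr _) in E; last by case/andP: ltYX.
have [k eX] : exists k, X = Y + k by exists (X - Y); lia.
have := double_sum_minn Y k; rewrite -eX; move: E.
by move: (pair_count _ _ _) (\sum_(a < X) _) => p s; rewrite eX; lia.
Qed.

(** Each [a < X.-1] allows [a.+1] values of [b] with [y < x] and [X - a] without; the last [a]
    allows only [b = a], without. *)
Lemma pair_count_all_eq X : pair_count xpredT X X = X * X.
Proof.
have E : pair_count xpredT X X + X = \sum_(a < X) X.+1.
  case: X => [|x]; first by rewrite pair_count0 big_ord0.
  rewrite /pair_count big_ord_recr /=.
  have /= -> : \sum_(b < x.+1)
     ((reduced x.+1 (Params x.+1 x x.+1 b true) && true) +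
      (reduced x.+1 (Params x.+1 x x.+1 b false) && true)) =
     \sum_(b < x.+1) (b == x :> nat).
    by apply: eq_bigr => b _; have := ltn_ord b; rewrite /= eqxx; lia.
  rewrite sum_eq_ord ltnSn sum_nat_const card_ord.
  rewrite (eq_bigr (fun a : 'I_x => x.+2)); first by rewrite sum_nat_const card_ord; lia.
  move=> a _; have lt_a := ltn_ord a.
  rewrite (eq_bigr (fun b : 'I_x.+1 => 1 + (b == a :> nat))) => [|b _].
    by rewrite big_split sum_nat_const card_ord sum_eq_ord /=; lia.
  by have := ltn_ord b; rewrite /= eqxx; lia.
by rewrite sum_nat_const card_ord in E; lia.
Qed.

(** Let [X = x.+1], [Y = y.+1]. With [y < x] as elements, asymmetry leaves [a < x] and
    [b < minn y a.+1]; otherwise [b < y] for each [a <= y], and all [b <= y] for [a = y.+1]. *)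
Lemma pair_count_asym_lt X Y : 0 < Y < X ->
  2 * pair_count asymmetric X Y + 2 * X = Y * Y + Y + 2 * X * Y.
Proof.
case: Y => // y; case: X => // x ltYX.
have E : pair_count asymmetric x.+1 y.+1 =
    \sum_(a < x) minn y a.+1 + (y * y.+1 + y.+1).
  rewrite /pair_count; under eq_bigr do rewrite big_split /=.
  rewrite big_split /=; congr (_ + _).
    rewrite big_ord_recr /= [X in _ + X]big1 ?addn0 => [|b _]; last first.
      by case: eqVneq; lia.
    apply: eq_bigr => a _; have lt_a := ltn_ord a.
    rewrite (eq_bigr (fun b : 'I_y.+1 => (b < minn y a.+1) : nat)) ?sum_ltn_ord; first lia.
    by move=> b _; have := ltn_ord b; case: eqVneq; lia.
  rewrite (@sum_ord_trunc y.+2 x.+1 (fun a => \sum_(b < y.+1)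
    ((reduced x.+1 (Params x.+1 a y.+1 b false) &&
      asymmetric (Params x.+1 a y.+1 b false)) : nat)));
   [|lia|]; last first.
    by move=> a le_a; rewrite big1 // => b _ /=; case: eqVneq; lia.
  rewrite big_ord_recr; congr (_ + _) => /=.
    rewrite (eq_bigr (fun=> y)); first by rewrite sum_nat_const card_ord mulnC.
    move=> a _; have lt_a := ltn_ord a.
    rewrite (eq_bigr (fun b : 'I_y.+1 => (b < y) : nat)) ?sum_ltn_ord; first lia.
    by move=> b _; have := ltn_ord b; case: eqVneq; lia.
  rewrite (eq_bigr (fun=> 1)); first by rewrite sum_nat_const card_ord muln1.
  by move=> b _; have := ltn_ord b; case: eqVneq; lia.
have [k eX] : exists k, x = y + k by exists (x - y); lia.
have := double_sum_minn y k; rewrite -eX; move: E.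
by move: (pair_count _ _ _) (\sum_(a < x) _) => p s; rewrite eX; lia.
Qed.

(** For [a, b <= x] exactly one value of the flag is admissible, true when [b <= a], except that
    [a = b = x] admits none. Larger [a] or [b] admit none either. *)
Lemma pair_count_asym_eq x : pair_count asymmetric x.+2 x.+2 + 1 = x.+1 * x.+1.
Proof.
have E : pair_count asymmetric x.+2 x.+2 + 1 = \sum_(a < x.+1) x.+1.
  rewrite /pair_count big_ord_recr /= [X in _ + X + _]big1 ?addn0 => [|b _]; last first.
    by have := ltn_ord b; rewrite !eqxx; lia.
  have <- : \sum_(a < x.+1) (a == x :> nat) = 1 by rewrite sum_eq_ord ltnSn.
  rewrite -big_split /=; apply: eq_bigr => a _; have lt_a := ltn_ord a.
  rewrite (@sum_ord_trunc x.+1 x.+2 (fun b =>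
     (reduced x.+2 (Params x.+2 a x.+2 b true) && asymmetric (Params x.+2 a x.+2 b true)) +
     (reduced x.+2 (Params x.+2 a x.+2 b false) && asymmetric (Params x.+2 a x.+2 b false)))) //.
    rewrite (eq_bigr (fun b : 'I_x.+1 => 1 - ((a == x :> nat) && (b == x :> nat)))).
      rewrite big_ord_recr /= eqxx andbT.
      rewrite (eq_bigr (fun=> 1)) ?sum_nat_const ?card_ord; first by case: eqP; lia.
      by move=> b _; have := ltn_ord b; case: eqP => //= _; case: eqP => //; lia.
    by move=> b _; have := ltn_ord b; rewrite /= !eqxx; lia.
  by move=> b le_b /=; rewrite !eqxx; lia.
by rewrite E sum_nat_const card_ord.
Qed.

Lemma pair_count_asym_eq1 : pair_count asymmetric 1 1 = 0.
Proof. by rewrite /pair_count !big_ord1. Qed.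

Lemma card_reduced_all h :
  6 * #|[set z : coded_params h | reduced h (decode z)]| + h ^ 2 = h ^ 4 + 4 * h ^ 3 + 2 * h.
Proof.
have -> : #|[set z : coded_params h | reduced h (decode z)]| =
  \sum_(X < h.+1) \sum_(Y < X.+1) pair_count xpredT X Y.
  by rewrite -card_reduced; apply: eq_card => z; rewrite !inE andbT.
elim: h => [|h IHh].
  by rewrite !big_ord1 pair_count0.
rewrite big_ord_recr /= mulnDr.
(* Partial sum of the row [X = h.+1] below the diagonal. The factor 12 clears the 2 of
   [pair_count_all_lt] and the 6 of the sum of squares. *)
have S m : m <= h -> 12 * \sum_(Y < m.+1) pair_count xpredT h.+1 Y + 12 * m =
    m * m.+1 * (2 * m + 1) + 9 * m * m.+1 + 6 * h.+1 * m * m.+1.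
  elim: m => [|m IHm] lt_m; first by rewrite big_ord1 pair_count0; lia.
  have := @pair_count_all_lt h.+1 m.+1 lt_m; have := IHm (ltnW lt_m).
  rewrite [in X in _ -> _ -> X]big_ord_recr /=.
  by move: (pair_count _ _ _) (\sum_(Y < m.+1) _) => p s; lia.
have := S h (leqnn h); rewrite [\sum_(Y < h.+2) _]big_ord_recr /= pair_count_all_eq.
move: IHh; move: (\sum_(X < h.+1) _) (\sum_(Y < h.+1) _) => p s.
by rewrite !expnS !expn0; lia.
Qed.

Lemma card_reduced_asym h :
  6 * #|[set z : coded_params h.+1 | reduced h.+1 (decode z) && asymmetric (decode z)]|
    + 4 * h.+1 ^ 2 + 4 * h.+1 = h.+1 ^ 4 + h.+1 ^ 3 + 6.
Proof.
rewrite card_reduced; elim: h => [|h IHh].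
  by rewrite !big_ord_recr !big_ord0 /= !pair_count0 pair_count_asym_eq1.
rewrite big_ord_recr /= mulnDr.
have S m : m <= h.+1 -> 12 * \sum_(Y < m.+1) pair_count asymmetric h.+2 Y + 12 * h.+2 * m =
    m * m.+1 * (2 * m + 1) + 3 * m * m.+1 + 6 * h.+2 * m * m.+1.
  elim: m => [|m IHm] lt_m; first by rewrite big_ord1 pair_count0; lia.
  have := @pair_count_asym_lt h.+2 m.+1 lt_m; have := IHm (ltnW lt_m).
  rewrite [in X in _ -> _ -> X]big_ord_recr /=.
  by move: (pair_count _ _ _) (\sum_(Y < m.+1) _) => p s; lia.
have := S h.+1 (leqnn _); rewrite [\sum_(Y < h.+3) _]big_ord_recr /=.
have := pair_count_asym_eq h.
move: IHh; move: (pair_count _ _ _) (\sum_(X < h.+2) _) (\sum_(Y < h.+2) _) => q p s.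
by rewrite !expnS !expn0; lia.
Qed.

End Counting.

(** * From normal forms to [p] and [u] *)

Lemma mem_posets_h h (R : {set 'I_h.+2 * 'I_h.+2}) :
  (R \in posets_h h.+2 (Posz h)) = is_poset R && (height R == h).
Proof. by rewrite inE. Qed.

Lemma model_posets_h h d : reduced h d -> model h d \in posets_h h.+2 (Posz h).
Proof.
move=> /reduced_valid vd.
by rewrite mem_posets_h model_poset // height_model // eqxx.
Qed.

Lemma posets_h_model h (R : {set 'I_h.+2 * 'I_h.+2}) :
  R \in posets_h h.+2 (Posz h) ->
  exists2 z : coded_params h, reduced h (decode z) & iso_posets (model h (decode z)) R.
Proof.
rewrite mem_posets_h => /andP[pR /eqP hR].
have [d vd dR] := exists_model pR hR; have [e re ed] := reduced_form vd.
have [z ze] := decode_reduced re; exists z; rewrite ze //.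
exact: iso_posets_trans ed dR.
Qed.

Lemma p_card h :
  p h.+2 (Posz h) = #|[set z : coded_params h | reduced h (decode z)]|.
Proof.
apply: (card_iso_classes (F := fun z => model h (decode z))) => //.
- by move=> z; rewrite inE; apply: model_posets_h.
- by move=> R /posets_h_model[z rz zR]; exists z; rewrite ?inE.
- by move=> z z'; rewrite !inE => rz rz' /(reduced_iso_eq rz rz') /decode_inj.
Qed.

(** Asymmetry gives rigidity and its failure a chain exchange; both are carried along the
    isomorphism from the model to [R]. *)
Lemma locally_unsymmetric_model h d (R : {set 'I_h.+2 * 'I_h.+2}) :
  reduced h d -> iso_posets (model h d) R ->
  locally_unsymmetric R <-> asymmetric d.
Proof.
move=> rd /iso_posetsP[t i]; split=> [unsymR|ad]; last first.
  by apply/rigid_locally_unsymmetric/(iso_by_rigid i); apply: asymmetric_rigid.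
apply: contraT => /(symmetric_chain_swap rd)[s [C sC]]; case: unsymR.
apply: chain_swap_locally_symmetric (iso_by_chain_swap i sC).
exact: iso_by_poset i (model_poset (reduced_valid rd)).
Qed.

Lemma u_card h : u h.+2 (Posz h) =
  #|[set z : coded_params h | reduced h (decode z) && asymmetric (decode z)]|.
Proof.
apply: (card_iso_classes (F := fun z => model h (decode z))) => //.
- by apply/subsetP => R; rewrite inE => /andP[].
- move=> z; rewrite inE => /andP[rz az]; rewrite inE model_posets_h //.
  by apply/asboolP/(locally_unsymmetric_model rz) => //; apply: iso_posets_refl.
- move=> R; rewrite inE => /andP[/posets_h_model[z rz zR] /asboolP unsymR].
  by exists z; rewrite // inE rz; apply/(locally_unsymmetric_model rz zR).
- move=> z z'; rewrite !inE => /andP[rz _] /andP[rz' _].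
  by move/(reduced_iso_eq rz rz')/decode_inj.
Qed.

Lemma posets_h_lt0 n (l : int) : (l < 0)%R -> posets_h n l = set0.
Proof.
move=> l0; apply/setP => R; rewrite !inE; apply/negbTE/negP => /andP[_ /eqP e].
by rewrite -e in l0.
Qed.

Lemma u_leq_p n l : u n l <= p n l.
Proof.
apply/subset_leq_card/subsetP => c /imsetP[R RB ->]; apply: imset_f.
by move: RB; rewrite inE => /andP[].
Qed.

Import GRing.Theory.
Local Open Scope ring_scope.

Theorem mainTheorem14 (n : nat) :
  ((n < 3)%N -> p n (n%:Z - 2) = 0%N /\ u n (n%:Z - 2) = 0%N) /\
  ((3 <= n)%N ->
     (p n (n%:Z - 2))%:Z * 6
       = (n%:Z - 2) * (n%:Z ^+ 3 - 2 * n%:Z ^+ 2 - 5 * n%:Z + 12) /\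
     (u n (n%:Z - 2))%:Z * 6
       = (n%:Z - 3) * (n%:Z ^+ 3 - 4 * n%:Z ^+ 2 + 2 * n%:Z - 2)).
Proof.
split=> [n_lt3|].
  suff p0 : p n (n%:Z - 2) = 0%N.
    by split=> //; have := u_leq_p n (n%:Z - 2); rewrite p0 leqn0 => /eqP.
  (* This settles [n < 2], where [n - 2] is negative while heights are natural numbers. *)
  have small (l : int) : l < 0 -> p n l = 0%N.
    by move=> l0; rewrite /p posets_h_lt0 // imset0 cards0.
  case: n n_lt3 small => [|[|[|]]] // _ small; try exact: small.
  have -> : 2%:Z - 2 = Posz 0 by [].
  (* For [n = 2] the counting polynomial vanishes at height 0. *)
  by have := card_reduced_all 0; rewrite p_card !expnS; lia.
case: n => [|[|[|h]]] // _.
have -> : h.+3%:Z - 2 = h.+1%:Z by lia.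
rewrite p_card u_card.
have := card_reduced_all h.+1; have := card_reduced_asym h.
move: #|_| #|_| => q r Eq Er.
(* The counts are polynomials in the height [h.+1], which equals [n - 2]; expanding powers leaves
   identities for [lia]. *)
rewrite !expnS !expn0 in Eq Er; rewrite !exprS !expr0; split; lia.
Qed.
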